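(* Let $(\mathbb{E},\mathcal{E})$ be a measurable space, $\Phi:\mathbb{R}^d\times\mathbb{E}\to\mathbb{R}^d$ measurable, $\varepsilon_1,\varepsilon_2,\dots$ i.i.d. random elements of $\mathbb{E}$ independent of the $\mathbb{R}^d$-valued random vector $X_0$, and define $X_t=\Phi(X_{t-1},\varepsilon_t)$ for $t=1,2,\dots$. Assume: (RV) there exist $\alpha>0$ and a non-degenerate probability measure $\Upsilon$ on $\mathbb{S}^{d-1}$ such that $\lim_{x\to\infty}\Pr(\|X_0\|>ux,\ X_0/\|X_0\|\in S\mid \|X_0\|>x)=u^{-\alpha}\Upsilon(S)$ for all $u\ge 1$ and all Borel $S\subset\mathbb{S}^{d-1}$ with $\Upsilon(\partial S)=0$; (Phi) there exists a measurable $\phi:\mathbb{S}^{d-1}\times\mathbb{E}\to\mathbb{R}^d$ such that for all $e\in\mathbb{E}$, $\lim_{x\to\infty}x^{-1}\Phi(xs(x),e)=\phi(s,e)$ whenever $s(x)\to s$ in $\mathbb{S}^{d-1}$; and if $\Pr(\phi(s,\varepsilon_1)=0)>0$ for some $s\in\mathbb{S}^{d-1}$, then $\Pr(\varepsilon_1\in\mathbb{W})=1$ for a measurable $\mathbb{W}\subset\mathbb{E}$ such that $\sup_{\|y\|\le x}\|\Phi(y,e)\|=O(x)$ as $x\to\infty$ for every $e\in\mathbb{W}$. Extend $\phi$ to $\mathbb{R}^d\times\mathbb{E}$ by $\phi(v,e)=\|v\|\phi(v/\|v\|,e)$ for $v\ne0$ and $\phi(0,e)=0$. Then for every integer $t\ge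 0$, as $x\to\infty$, $$\mathcal{L}\Big(\tfrac{\|X_0\|}{x},\tfrac{X_0}{\|X_0\|},\tfrac{X_1}{\|X_0\|},\dots,\tfrac{X_t}{\|X_0\|}\ \Big|\ \|X_0\|>x\Big)\Rightarrow \mathcal{L}(Y,M_0,M_1,\dots,M_t),$$ where $M_j=\phi(M_{j-1},\varepsilon_j)$ for $j\ge1$, and $Y,M_0,\varepsilon_1,\varepsilon_2,\dots$ are independent with $\Pr(Y>y)=y^{-\alpha}$ for $y\ge1$ and $\mathcal{L}(M_0)=\Upsilon$.
   Context: $\|\cdot\|$ is the Euclidean norm, $\mathbb{S}^{d-1}$ the unit sphere in $\mathbb{R}^d$, $\mathcal{L}(\cdot)$ denotes law and $\Rightarrow$ weak convergence. The process $\{M_t\}$ is called the forward tail chain. *)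

(* Defs.v *)
From HB Require Import structures.
From mathcomp Require Import all_boot all_order all_algebra.
From mathcomp Require Import all_classical all_reals all_analysis.
Set Implicit Arguments. Unset Strict Implicit. Unset Printing Implicit Defensive.
Import Order.TTheory GRing.Theory Num.Theory.
Import numFieldNormedType.Exports.
Local Open Scope classical_set_scope.
Local Open Scope ring_scope.

Section defs.
Context {R : realType}.

Definition Rd (d : nat) := g_sigma_algebraType (@open 'rV[R]_d).

Definition enorm {d : nat} (v : 'rV[R]_d) : R := Num.sqrt (\sum_(i < d) v ord0 i ^+ 2).

Definition sphere (d : nat) : set 'rV[R]_d := [set v | enorm v = 1].

Definition sph_boundary {d : nat} (S : set 'rV[R]_d) : set 'rV[R]_d :=
  closure S `\` [set s | S s /\ exists e : R, 0 < e /\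
     ([set y | enorm (y - s) < e] `&` @sphere d) `<=` S].

Definition phi_ext {d : nat} {E : Type} (phi : 'rV[R]_d -> E -> 'rV[R]_d)
  (v : 'rV[R]_d) (e : E) : 'rV[R]_d :=
  if v == 0 then 0 else enorm v *: phi ((enorm v)^-1 *: v) e.

(* X_0 = X0, X_{t+1} = Phi(X_t, eps t)   (eps t stands for epsilon_{t+1}) *)
Fixpoint Xproc {d : nat} {Omega E : Type} (Phi : 'rV[R]_d -> E -> 'rV[R]_d)
  (X0 : Omega -> 'rV[R]_d) (eps : nat -> Omega -> E) (t : nat) (w : Omega)
  : 'rV[R]_d :=
  match t with
  | 0 => X0 w
  | t'.+1 => Phi (Xproc Phi X0 eps t' w) (eps t' w)
  end.

(* Iterated integration along the chain M_j = phi(M_{j-1}, eps_j) with fresh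
   independent innovations distributed as eps 0 under P:
   pathInt P eps phi k F m0 = E[ F(M_0, ..., M_k, M_k, M_k, ...) | M_0 = m0 ]. *)
Fixpoint pathInt {d : nat} {dO dE} {Omega : measurableType dO}
  {E : measurableType dE} (P : probability Omega R) (eps : nat -> Omega -> E)
  (phi : 'rV[R]_d -> E -> 'rV[R]_d) (k : nat)
  (F : (nat -> 'rV[R]_d) -> R) (m0 : 'rV[R]_d) : R :=
  match k with
  | 0 => F (fun _ => m0)
  | k'.+1 => fine (\int[P]_w
      (pathInt P eps phi k'
         (fun p => F (fun j => if j == 0%N then m0 else p j.-1))
         (phi m0 (eps 0%N w)))%:E)
  end.

Definition iid_indep_of {d : nat} {dO dE} {Omega : measurableType dO}
  {E : measurableType dE} (P : probability Omega R)
  (X0 : Omega -> Rd d) (eps : nat -> Omega -> E) : Prop :=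
  (forall (n : nat) (A : set (Rd d)) (B : nat -> set E),
      measurable A -> (forall i, measurable (B i)) ->
      fine (P (X0 @^-1` A `&` \bigcap_(i in `I_n) (eps i @^-1` B i))) =
      fine (P (X0 @^-1` A)) * \prod_(i < n) fine (P (eps i @^-1` B i)))
  /\ (forall (i : nat) (B : set E), measurable B ->
      P (eps i @^-1` B) = P (eps 0%N @^-1` B)).

End defs.
Arguments sphere {R} d.

(* Main.v *)
(** Iterating [x^-1 Phi(x s, e) -> phi(s, e)] shows that, given
    [X_0 = r s], the expectation of a bounded continuous function of the
    rescaled path converges, as [r] tends to infinity, uniformly for [s] on the
    sphere and the first coordinate in a compact interval, to the expectation
    along the tail chain.  A path is continued through [0] by the growth
    condition when [phi(s, eps)] may vanish, and almost surely avoids [0]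
    otherwise.  By independence of the innovations it remains to integrate the
    limit against the law of [(|X_0| / x, X_0 / |X_0|)] given [|X_0| > x].
    Cutting the radial coordinate into small intervals reduces this to
    functions of the direction [X_0 / |X_0|] on events [|X_0| > u x], and for
    those the layer-cake formula applies, because all but negligibly many level
    sets of a function are null for the angular law. *)

Require Import Defs.
From HB Require Import structures.
From mathcomp Require Import all_boot all_order all_algebra.
From mathcomp Require Import all_classical all_reals all_analysis.
From mathcomp Require Import measurable_realfun ring lra.
Set Implicit Arguments.
Unset Strict Implicit.
Unset Printing Implicit Defensive.
Import Order.TTheory GRing.Theory Num.Theory.
Import numFieldNormedType.Exports.
Local Open Scope classical_set_scope.
Local Open Scope ring_scope.

(** * Measurability of maps into finite-dimensional spaces *)

(** The hypothesis on [Phi] speaks of curves of directions, so what it yields is continuous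
    convergence: rescaled kernels converge along every [r_ n --> +oo] and [m_ n --> m]. Unlike
    pointwise convergence this mode survives iteration, since the random state produced by one step
    is a convergent argument of the next; compactness of the sphere times [[1, B]] then turns it
    into uniformity. It can break only at the state 0, where a direction is undefined. The shape of
    the last half is dictated by (RV), which controls only events [u x < |X_0|] with fixed [u >= 1],
    joined with directional sets whose boundary is null. Functions of the radius therefore enter
    through differences of indicators of such events, and functions of the direction through
    superlevel sets, at a level drawn uniformly from [0, 1] so that bounded convergence in the level
    applies. Cutting the radius off at [B] costs about [C B^(-alpha)]. *)

Section discretization.
Context {R : realType}.

(* Covers an open set by the countably many cells of the discretizations [k n]
   that it contains. *)
Lemma measurable_preimage_discretize {dT} {T : measurableType dT}
    {V : pseudoMetricType R} {C : countType} (k : nat -> V -> C) (g : T -> V) :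
  (forall v e, 0 < e -> exists n, forall v', k n v' = k n v -> ball v e v') ->
  (forall n c, measurable [set z | k n (g z) = c]) ->
  forall U : set V, open U -> measurable (g @^-1` U).
Proof.
move=> kfine mk U oU.
pose F (nc : nat * C) : set T :=
  if pselect (k nc.1 @^-1` [set nc.2] `<=` U) then [set z | k nc.1 (g z) = nc.2]
  else set0.
have -> : g @^-1` U = \bigcup_nc F nc.
  apply/seteqP; split => [z Uz|z [[n c] _]].
    have /nbhs_ballP[e /= e20 eU] : nbhs (g z) U by exact: open_nbhs_nbhs.
    have [n kn] := kfine (g z) _ e20.
    exists (n, k n (g z)) => //; rewrite /F; case: pselect => //= -[].
    by move=> v' /= kv'; apply/eU/kn.
  by rewrite /F; case: pselect => //= /(_ (g z)) /= h /h.
apply: countable_bigcupT_measurable => [|[n c]]; first exact: countableP.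
by rewrite /F; case: pselect => //= _; exact: mk.
Qed.

Lemma measurable_floor_eq {dT} {T : measurableType dT} (a : T -> R) (c : int) (n : nat) :
  measurable_fun setT a ->
  measurable [set z | Num.floor (a z * n%:R) = c].
Proof.
move=> ma.
have -> : [set z | Num.floor (a z * n%:R) = c] =
   setT `&` (fun z => a z * n%:R) @^-1` `[c%:~R, (c + 1)%:~R[.
  apply/seteqP; split => [z /= <-|z /= [_]].
    by split => //; rewrite in_itv /=; apply: floor_itv.
  by rewrite in_itv /= => h; apply/eqP; rewrite floor_eq.
by apply: measurable_funM; first exact: ma.
Qed.

Lemma floor_eq_dist (x y : R) (n : nat) (e : R) : 1 < e * n%:R -> 0 < e ->
  Num.floor (y * n%:R) = Num.floor (x * n%:R) -> `|x - y| < e.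
Proof.
move=> ne e0 h.
have n0 : 0 < n%:R :> R by rewrite -(pmulr_rgt0 _ e0) (lt_trans ltr01).
have := floor_itv (x * n%:R); have := floor_itv (y * n%:R); rewrite h.
move: (Num.floor _) => c; rewrite intrD => /andP[h1 h2] /andP[h3 h4].
suff : `|x - y| * n%:R < e * n%:R by rewrite ltr_pM2r.
apply: le_lt_trans ne; rewrite -[X in _ * X]gtr0_norm // -normrM mulrBl ler_norml.
by apply/andP; split; lra.
Qed.

Lemma mx_discretize {m n : nat} (v : R * 'M[R]_(m, n)) (e : R) : 0 < e -> exists N : nat,
  forall v', (Num.floor (v'.1 * N%:R), map_mx (fun x => Num.floor (x * N%:R)) v'.2) =
             (Num.floor (v.1 * N%:R), map_mx (fun x => Num.floor (x * N%:R)) v.2) ->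
  ball v e v'.
Proof.
move=> e0; have [N hN] : exists N : nat, 1 < e * N%:R.
  exists (Num.truncn e^-1).+1; rewrite mulrC -ltr_pdivrMr // mul1r.
  by rewrite truncnS_gt.
exists N => v' [h1 h2]; split => /=.
  by rewrite /ball /= (floor_eq_dist hN).
split => // i j; rewrite /ball /=; apply: (floor_eq_dist hN) => //.
by move/matrixP : h2 => /(_ i j); rewrite !mxE.
Qed.

(** A cell prescribes the floors of finitely many rescaled coordinates, so coordinatewise
    measurability makes every cell measurable. The product [R * 'M] is the domain of the test
    function. *)
Lemma measurable_preimage_open_mx {dT} {T : measurableType dT} {m n : nat}
    (a : T -> R) (p : T -> 'M[R]_(m, n)) (U : set (R * 'M[R]_(m, n))) :
  measurable_fun setT a -> (forall i j, measurable_fun setT (fun z => p z i j)) ->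
  open U -> measurable [set z | U (a z, p z)].
Proof.
move=> ma mp oU.
pose k (N : nat) (v : R * 'M[R]_(m, n)) : int * 'M[int]_(m, n) :=
  (Num.floor (v.1 * N%:R), map_mx (fun x => Num.floor (x * N%:R)) v.2).
apply: (@measurable_preimage_discretize _ _ _ _ k (fun z => (a z, p z))) => //.
  by move=> v e e0; exact: mx_discretize.
move=> N [c1 c2].
have -> : [set z | k N (a z, p z) = (c1, c2)] =
    [set z | Num.floor (a z * N%:R) = c1] `&`
    \bigcap_(ij in [set: 'I_m * 'I_n]) [set z | Num.floor (p z ij.1 ij.2 * N%:R) = c2 ij.1 ij.2].
  apply/seteqP; split => [z /= [<- <-]|z /= [<- h]].
    by split => // -[i j] _ /=; rewrite mxE.
  by congr pair; apply/matrixP => i j; rewrite mxE (h (i, j)).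
apply: measurableI; first exact: measurable_floor_eq.
apply: fin_bigcap_measurable => // -[i j] _; exact: measurable_floor_eq.
Qed.

Lemma measurable_fun_continuous_mx {dT} {T : measurableType dT} {m n : nat}
    (f : R * 'M[R]_(m, n) -> R) (a : T -> R) (p : T -> 'M[R]_(m, n)) :
  continuous f -> measurable_fun setT a ->
  (forall i j, measurable_fun setT (fun z => p z i j)) ->
  measurable_fun setT (fun z => f (a z, p z)).
Proof.
move=> cf ma mp; apply: (measurability _ (RGenOpens.measurableE R)).
move=> _ [_ [a' [b' ->] <-]]; rewrite setTI.
apply: (measurable_preimage_open_mx (U := f @^-1` `]a', b'[%classic)) => //.
by move/continuousP : cf; apply; exact: interval_open.
Qed.

Lemma measurable_fun_RdP {dT} {T : measurableType dT} {d} (g : T -> 'rV[R]_d) :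
  measurable_fun setT (g : T -> Rd d) <->
  forall i, measurable_fun setT (fun z => g z ord0 i).
Proof.
split => [mg i|mg].
  pose p (v : Rd d) : R := (v : 'rV[R]_d) ord0 i.
  apply: (measurableT_comp (f := p)) => //.
  apply: (measurability _ (RGenOpens.measurableE R)).
  move=> _ [_ [a' [b' ->] <-]]; rewrite setTI.
  apply: sub_sigma_algebra.
  have /continuousP := @coord_continuous R 1 d ord0 i; apply.
  exact: interval_open.
apply: (@measurability _ _ _ (Rd d) setT g (@open 'rV[R]_d)) => //.
move=> _ [U oU <-]; rewrite setTI.
(* A dummy real coordinate 0 brings the claim under the product version. *)
have -> : g @^-1` U = [set z | ([set: R] `*` U) (0, g z)].
  by apply/seteqP; split => z //= [].
apply: measurable_preimage_open_mx => [//|i j|]; first by rewrite (ord1 i).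
have -> : [set: R] `*` U = (@snd R 'rV[R]_d) @^-1` U.
  by apply/seteqP; split => x //= [].
by apply: open_comp => // x _; exact: cvg_snd.
Qed.

End discretization.

(** * Bounded integrands and iterated integrals along a chain *)

Section bounded_integration.
Context {R : realType} {dQ} {T : measurableType dQ} (Q : probability T R).

Lemma integrable_bounded (f : T -> R) (C : R) :
  measurable_fun setT f -> (forall x, `|f x| <= C) -> Q.-integrable setT (EFin \o f).
Proof.
move=> mf fC; apply: measurable_bounded_integrable => //.
  exact: (le_lt_trans (probability_le1 Q measurableT) (ltry _)).
exists C; split; first exact: num_real.
by move=> M CM x _; exact: (le_trans (fC x) (ltW CM)).
Qed.

Lemma Rintegral_prob_cst (C : R) : \int[Q]_x C = C.
Proof.
rewrite Rintegral_cst //.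
by have /= -> := @probability_setT _ _ _ Q; rewrite mulr1.
Qed.

Lemma Rintegral_bounded (f : T -> R) (C : R) :
  measurable_fun setT f -> (forall x, `|f x| <= C) -> `|\int[Q]_x f x| <= C.
Proof.
move=> mf fC; have If := integrable_bounded mf fC.
apply: le_trans (le_normr_Rintegral measurableT If) _.
rewrite -[leRHS]Rintegral_prob_cst; apply: le_Rintegral => //.
- apply: (@integrable_bounded _ C); first exact: measurableT_comp.
  by move=> x; rewrite normr_id.
- by apply: (@integrable_bounded _ `|C|) => // x.
Qed.

Lemma bounded_cvg_Rintegral (f_ : nat -> T -> R) (f : T -> R) (C : R) :
  (forall n, measurable_fun setT (f_ n)) -> measurable_fun setT f ->
  (forall n x, `|f_ n x| <= C) ->
  {ae Q, forall x, f_ n x @[n --> \oo] --> f x} ->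
  \int[Q]_x f_ n x @[n --> \oo] --> \int[Q]_x f x.
Proof.
move=> mf_ mf fC ff.
have IC : Q.-integrable setT (EFin \o (fun=> C)).
  by apply: (@integrable_bounded _ `|C|).
have [||||If _] := @dominated_convergence _ _ _ Q setT measurableT
  (fun n => EFin \o f_ n) (EFin \o f) (EFin \o (fun=> C)) _ _ _ IC.
- by move=> n; apply/measurable_EFinP.
- exact/measurable_EFinP.
- by apply: filterS ff => x fx _; apply/cvg_EFin => //; exact: nearW.
- by apply: aeW => x n _; rewrite /= lee_fin.
rewrite -[X in _ --> X]fineK; last exact: integrable_fin_num.
by move=> h; apply: (fine_cvg h).
Qed.

(** Adding [C] makes the integrand nonnegative, so that Tonelli's measurability statement applies;
    the constant is subtracted again after integration. *)
Lemma measurable_Rintegral_param {dS} {S : measurableType dS} (h : S * T -> R) (C : R) :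
  measurable_fun setT h -> (forall z, `|h z| <= C) ->
  measurable_fun setT (fun s => \int[Q]_t h (s, t)).
Proof.
move=> mh hC.
have -> : (fun s => \int[Q]_t h (s, t)) = (fun s => \int[Q]_t (h (s, t) + C) - C).
  apply/funext => s; rewrite RintegralD //.
  - by rewrite Rintegral_prob_cst addrK.
  - by apply: (@integrable_bounded _ C) => //; exact: measurableT_comp.
  - by apply: (@integrable_bounded _ `|C|).
apply: measurable_funB => //; apply: measurableT_comp => //.
apply: (@measurable_fun_fubini_tonelli_F _ _ _ _ _ Q (fun z => (h z + C)%:E)) => //.
  by apply/measurable_EFinP; apply: measurable_funD.
by move=> z; rewrite lee_fin; have := hC z; rewrite ler_norml => /andP[]; lra.
Qed.

End bounded_integration.

Section pathInt_measurability.
Context {R : realType} {d : nat}.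

(** Measurability of a path functional is expressed by substituting measurable maps, in place of a
    sigma-algebra on sequences. The parameter in [T] will carry innovations and past states. *)
Definition mpath {dT} {T : measurableType dT} (F : T -> (nat -> 'rV[R]_d) -> R) :=
  forall dS (S : measurableType dS) (g : S -> T) (q : nat -> S -> 'rV[R]_d),
    measurable_fun setT g -> (forall j, measurable_fun setT (q j : S -> Rd d)) ->
    measurable_fun setT (fun z => F (g z) (q^~ z)).

(** Names the path built in the recursive clause of [pathInt], so that [pathIntS] holds by
    conversion. *)
Definition pcons (m : 'rV[R]_d) (p : nat -> 'rV[R]_d) : nat -> 'rV[R]_d :=
  fun j => if j == 0%N then m else p j.-1.

Lemma mpath_pcons {dT} {T : measurableType dT} (F : T -> (nat -> 'rV[R]_d) -> R)
    (q : T -> 'rV[R]_d) : mpath F -> measurable_fun setT (q : T -> Rd d) ->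
  mpath (fun z p => F z (pcons (q z) p)).
Proof.
move=> mF mq dS S g q' mg mq'.
rewrite (_ : (fun z => _) =
  (fun z => F (g z) ((fun j z => if j == 0%N then q (g z) else q' j.-1 z)^~ z))) //.
apply: mF => // -[|j] //=; exact: (measurableT_comp mq mg).
Qed.

Lemma mpath_comp {dT dU} {T : measurableType dT} {U : measurableType dU}
  (F : T -> (nat -> 'rV[R]_d) -> R) (h : U -> T) :
  mpath F -> measurable_fun setT h -> mpath (F \o h).
Proof.
by move=> mF mh dS S g q mg mq; apply: (mF _ _ (h \o g)) => //; exact: measurableT_comp.
Qed.

Context {dO} {Omega : measurableType dO} (P : probability Omega R).
Context {dE} {E : measurableType dE} (phi : 'rV[R]_d -> E -> 'rV[R]_d).
Context (eps : nat -> Omega -> E).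
Hypothesis mphi : measurable_fun [set: Rd d * E] (fun z => (phi z.1 z.2 : Rd d)).
Hypothesis meps : measurable_fun setT (eps 0%N).

Lemma pathIntS k F m : pathInt P eps phi k.+1 F m =
  \int[P]_w pathInt P eps phi k (fun p => F (pcons m p)) (phi m (eps 0%N w)).
Proof. by []. Qed.

Lemma measurable_kernel {dT} {T : measurableType dT} (q : T -> 'rV[R]_d) (e : T -> E) :
  measurable_fun setT (q : T -> Rd d) -> measurable_fun setT e ->
  measurable_fun setT (fun z => phi (q z) (e z) : Rd d).
Proof.
move=> mq me.
apply: (measurableT_comp (f := fun z : Rd d * E => phi z.1 z.2 : Rd d)
  (g := fun z => (q z : Rd d, e z))) => //.
by apply/measurable_fun_pairP; split.
Qed.

(** The two claims need each other: integrating over a parameter preserves measurability for bounded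
    integrands, and bounding an integral requires a measurable integrand. The parameter space is
    quantified under [k] because the inductive step enlarges it to [T * Omega]. *)
Lemma pathInt_measurable_bounded k :
  (forall dT (T : measurableType dT) (F : T -> (nat -> 'rV[R]_d) -> R) q C,
    mpath F -> (forall z p, `|F z p| <= C) -> measurable_fun setT (q : T -> Rd d) ->
    measurable_fun setT (fun z => pathInt P eps phi k (F z) (q z))) /\
  (forall dT (T : measurableType dT) (F : T -> (nat -> 'rV[R]_d) -> R) C,
    mpath F -> (forall z p, `|F z p| <= C) ->
    forall z m, `|pathInt P eps phi k (F z) m| <= C).
Proof.
elim: k => [|k [IHm IHb]].
  split => [dT T F q C mF FC mq|dT T F C mF FC z m]; last exact: FC.
  by apply: (mF _ _ id (fun _ => q)).
split => [dT T F q C mF FC mq|dT T F C mF FC z m].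
  pose h (z : T * Omega) :=
    pathInt P eps phi k (fun p => F z.1 (pcons (q z.1) p)) (phi (q z.1) (eps 0%N z.2)).
  have mF' : mpath (fun (z : T * Omega) p => F z.1 (pcons (q z.1) p)).
    by apply: (mpath_comp (F := fun z p => F z (pcons (q z) p))) => //; exact: mpath_pcons.
  apply: (@measurable_Rintegral_param _ _ _ P _ _ h C).
    apply: (IHm _ _ _ _ C mF') => [z p|]; first exact: FC.
    apply: measurable_kernel; first exact: (measurableT_comp mq measurable_fst).
    exact: (measurableT_comp meps measurable_snd).
  move=> z; exact: (IHb _ _ _ _ mF').
have mF' : mpath (fun (w : Omega) p => F z (pcons m p)).
  have mc : mpath (fun (w : Omega) p => F z p).
    by move=> dS S g q mg mq; apply: (mF _ _ (fun=> z)).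
  exact: (mpath_pcons (q := fun=> m) mc).
rewrite pathIntS; apply: Rintegral_bounded => [|w]; last exact: (IHb _ _ _ _ mF' _ w).
apply: (IHm _ _ (fun w p => F z (pcons m p)) (fun w => phi m (eps 0%N w)) C) => //.
exact: measurable_kernel.
Qed.

Lemma pathInt_measurable k dT (T : measurableType dT) (F : T -> (nat -> 'rV[R]_d) -> R) q C :
  mpath F -> (forall z p, `|F z p| <= C) -> measurable_fun setT (q : T -> Rd d) ->
  measurable_fun setT (fun z => pathInt P eps phi k (F z) (q z)).
Proof. by move: C; apply: (pathInt_measurable_bounded k).1. Qed.

Lemma pathInt_bounded k dT (T : measurableType dT) (F : T -> (nat -> 'rV[R]_d) -> R) C :
  mpath F -> (forall z p, `|F z p| <= C) ->
  forall z m, `|pathInt P eps phi k (F z) m| <= C.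
Proof. exact: (pathInt_measurable_bounded k).2. Qed.

End pathInt_measurability.

(** * Independence and the Markov property *)

Section independence.
Context {R : realType} {dO} {Omega : measurableType dO} (P : probability Omega R).
Context {dE} {E : measurableType dE}.

(* The integral on the left only sees the law of [(w, e w)] on the product of
   [Omega], endowed with the sigma-algebra generated by [G], and [E]; by
   independence this law is a product measure. *)
Lemma indep_Rintegral (G : set (set Omega)) (e e0 : Omega -> E) :
  G `<=` measurable -> setI_closed G -> G setT ->
  measurable_fun setT e -> measurable_fun setT e0 ->
  (forall A B, G A -> measurable B ->
     P (A `&` e @^-1` B) = (P A * P (e0 @^-1` B))%E) ->
  forall (h : g_sigma_algebraType G * E -> R) (C : R),
    measurable_fun setT h -> (forall z, `|h z| <= C) ->
    \int[P]_w h (w, e w) = \int[P]_w \int[P]_w' h (w, e0 w').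
Proof.
move=> GM GI GT me me0 PG h C mh hC.
pose OG := g_sigma_algebraType G.
have sub (A : set OG) : measurable A -> @measurable _ Omega A.
  apply: smallest_sub => //; exact: sigma_algebra_measurable.
have mid : measurable_fun [set: Omega] (id : Omega -> OG).
  by move=> _ A /sub; rewrite setTI.
(* For fixed [B] both sides are finite measures in [A] agreeing on the pi-system [G], hence on the
   sigma-algebra it generates. *)
have PGs A B : <<s G >> A -> measurable B ->
    P (A `&` e @^-1` B) = (P A * P (e0 @^-1` B))%E.
  move=> sA mB; have meB : measurable (e @^-1` B) by rewrite -[X in measurable X]setTI; exact: me.
  have r0 : 0 <= fine (P (e0 @^-1` B)) by rewrite fine_ge0.
  have mE X : mscale (NngNum r0) P X = (P X * P (e0 @^-1` B))%E.
    rewrite /mscale muleC; congr (_ * _)%E; apply: fineK; apply: fin_num_measure.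
    by rewrite -[X in measurable X]setTI; exact: me0.
  rewrite -mE; apply: (@g_sigma_algebra_measure_unique _ _ _ G GM (fun=> setT)
      (fun=> GT) _ (mrestr P meB) (mscale (NngNum r0) P) GI _ _ A sA).
  - by rewrite bigcup_const.
  - by move=> B' GB'; apply: eq_trans (PG _ _ GB' mB) _; exact/esym/mE.
  - move=> _; apply: (le_lt_trans (probability_le1 P _)); last exact: ltry.
    exact: measurableI.
have mj : measurable_fun setT (fun w : Omega => (w : OG, e w)).
  by apply/measurable_fun_pairP; split.
pose J : {mfun Omega >-> (OG * E)%type} := HB.pack (fun w : Omega => (w : OG, e w))
  (isMeasurableFun.Build _ _ _ _ _ mj).
pose I : {mfun Omega >-> OG} := HB.pack (id : Omega -> OG)
  (isMeasurableFun.Build _ _ _ _ _ mid).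
pose e0' : {mfun Omega >-> E} := HB.pack e0 (isMeasurableFun.Build _ _ _ _ _ me0).
have mJ X : measurable X -> (distribution P I \x distribution P e0')%E X = distribution P J X.
  apply: product_measure_unique => A B mA mB; exact: PGs.
have Eh (S : measurableType _) (Q : probability S R) (f : S -> R) C' :
    measurable_fun setT f -> (forall z, `|f z| <= C') ->
  (\int[Q]_s (f s)%:E)%E = (\int[Q]_s f s)%:E.
  move=> mf fC; rewrite /Rintegral fineK //; apply: integrable_fin_num => //.
  exact: (integrable_bounded Q mf fC).
have mhE : measurable_fun setT (EFin \o h) by apply/measurable_EFinP.
have hE w : (\int[P]_w' h (w, e0 w'))%:E = fubini_F (distribution P e0') (EFin \o h) w.
  rewrite /fubini_F integral_distribution //.
  - rewrite -(Eh _ _ _ (fun w' => h (w, e0 w')) C) //.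
    exact: (measurableT_comp mh (measurableT_comp (pair1_measurable (w : OG)) me0)).
  - exact: (measurableT_comp mhE (pair1_measurable (w : OG))).
  - apply: (@integrable_bounded _ _ _ P _ C) => //.
    exact: (measurableT_comp mh (measurableT_comp (pair1_measurable (w : OG)) me0)).
apply: EFin_inj; rewrite -(Eh _ _ _ (fun w => h (w, e w)) C) //; last first.
  exact: (measurableT_comp mh mj).
transitivity (\int[distribution P J]_z (h z)%:E)%E.
  rewrite integral_distribution //.
  apply: (@integrable_bounded _ _ _ P _ C) => //.
  exact: (measurableT_comp mh mj).
transitivity (\int[distribution P I \x distribution P e0']_z (h z)%:E)%E.
  apply: eq_measure_integral => X mX _; exact/esym/mJ.
have Ih : (distribution P I \x distribution P e0')%E.-integrable setT (EFin \o h).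
  apply: measurable_bounded_integrable => //.
    apply: le_lt_trans (ltry 1).
    apply: le_trans (probability_le1 (distribution P J) measurableT).
    exact: (eq_ind_r (fun x => (x <= _)%E) (lexx _) (mJ _ measurableT)).
  exists C; split; first exact: num_real.
  by move=> M CM x _; exact: (le_trans (hC x) (ltW CM)).
pose g (w : OG) := \int[P]_w' h (w, e0 w').
have gC w : `|g w| <= C.
  apply: Rintegral_bounded => //.
  exact: (measurableT_comp mh (measurableT_comp (pair1_measurable (w : OG)) me0)).
have mg : measurable_fun setT g.
  apply: (@measurable_Rintegral_param _ _ _ P _ _ (fun z : OG * Omega => h (z.1, e0 z.2)) C) => //.
  apply: (measurableT_comp mh (g := fun z : OG * Omega => (z.1, e0 z.2))).
  apply/measurable_fun_pairP; split; first exact: measurable_fst.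
  exact: (measurableT_comp me0 measurable_snd).
rewrite -(integral12_prod_meas1 Ih).
transitivity (\int[distribution P I]_x (g x)%:E)%E.
  by apply: eq_integral => w _; rewrite -hE.
rewrite integral_distribution.
- by apply: (Eh _ _ P g C) => //; exact: (measurableT_comp mg mid).
- exact/measurable_EFinP.
- by apply: (@integrable_bounded _ _ _ P g C) => //; exact: (measurableT_comp mg mid).
Qed.
End independence.

Section markov_property.
Context {R : realType} {d : nat}.
Context {dO} {Omega : measurableType dO} (P : probability Omega R).
Context {dE} {E : measurableType dE} (Phi : 'rV[R]_d -> E -> 'rV[R]_d).
Context (X0 : Omega -> 'rV[R]_d) (eps : nat -> Omega -> E).
Hypothesis mPhi : measurable_fun [set: Rd d * E] (fun z => (Phi z.1 z.2 : Rd d)).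
Hypothesis mX0 : measurable_fun setT (X0 : Omega -> Rd d).
Hypothesis meps : forall i, measurable_fun setT (eps i).
Hypothesis iid : iid_indep_of P (X0 : Omega -> Rd d) eps.

(** The rectangles of [iid_indep_of]: a pi-system generating the information of [X0] and the first
    [k] innovations. The innovation [eps k], which produces the state at time [k.+1], is the first
    one outside. *)
Definition past (k : nat) : set (set Omega) :=
  [set A | exists (A0 : set (Rd d)) (B : nat -> set E),
     [/\ measurable A0, forall i, measurable (B i) &
         A = X0 @^-1` A0 `&` \bigcap_(i in `I_k) (eps i @^-1` B i)]].

Lemma past_measurable k : past k `<=` measurable.
Proof.
move=> A [A0 [B [mA0 mB ->]]]; apply: measurableI.
  by rewrite -[X in measurable X]setTI; exact: mX0.
apply: fin_bigcap_measurable; first exact: finite_II.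
move=> i _.
by rewrite -[X in measurable X]setTI; exact: meps.
Qed.

Lemma past_setI k : setI_closed (past k).
Proof.
move=> _ _ [A [B [mA mB ->]]] [A' [B' [mA' mB' ->]]].
exists (A `&` A'), (fun i => B i `&` B' i); split.
- exact: measurableI.
- by move=> i; exact: measurableI.
- by rewrite preimage_setI bigcapI setIACA.
Qed.

Lemma past_rect k A0 B : measurable (A0 : set (Rd d)) -> (forall i, measurable (B i)) ->
  past k (X0 @^-1` A0 `&` \bigcap_(i in `I_k) (eps i @^-1` B i)).
Proof. by move=> mA0 mB; exists A0, B. Qed.

Lemma past_setT k : past k setT.
Proof.
have := @past_rect k setT (fun=> setT) measurableT (fun=> measurableT).
by rewrite preimage_setT setTI bigcapT.
Qed.

(** The product formula for [k.+1] innovations, with [B] in the last place, splits off its last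
    factor; what remains is the formula for [k], and equality in law replaces [eps k] by [eps 0]. *)
Lemma past_indep k A B : past k A -> measurable B ->
  P (A `&` eps k @^-1` B) = (P A * P (eps 0%N @^-1` B))%E.
Proof.
move=> [A0 [B' [mA0 mB' ->]]] mB.
have meB i : measurable (eps i @^-1` B).
  by rewrite -[X in measurable X]setTI; exact: meps.
have mR := past_measurable (past_rect k mA0 mB').
case: iid => ind idd.
pose B1 i := if (i < k)%N then B' i else B.
have mB1 i : measurable (B1 i) by rewrite /B1; case: ifP.
have h1 := ind k _ _ mA0 mB'; have h2 := ind k.+1 _ _ mA0 mB1.
have e2 : X0 @^-1` A0 `&` \bigcap_(i in `I_k.+1) (eps i @^-1` B1 i) =
    X0 @^-1` A0 `&` \bigcap_(i in `I_k) (eps i @^-1` B' i) `&` eps k @^-1` B.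
  rewrite -setIA; congr (_ `&` _); apply/seteqP; split => [w hw|w [hw hk] i /= ik].
    split => [i /= ik|].
      by have := hw i; rewrite /B1 /= ik; apply; rewrite ltnS ltnW.
    by have := hw k (ltnSn k); rewrite /B1 /= ltnn.
  by rewrite /B1; case: ltnP => [/hw//|ki]; have -> : i = k by apply/eqP; rewrite eqn_leq -ltnS ik.
move: h2; rewrite big_ord_recr /= e2 /B1 ltnn idd //.
rewrite (eq_bigr (fun i : 'I_k => fine (P (eps i @^-1` B' i)))); last first.
  by move=> i _; rewrite ltn_ord.
rewrite mulrA -h1 => h2.
rewrite -[LHS]fineK; last by apply: fin_num_measure; exact: measurableI.
by rewrite h2 EFinM !fineK //; exact: fin_num_measure.
Qed.

Local Notation X := (Xproc Phi X0 eps).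

Lemma Xproc_past_measurable k j : (j <= k)%N ->
  measurable_fun setT (X j : g_sigma_algebraType (past k) -> Rd d).
Proof.
elim: j => [_|j IH jk].
  move=> _ A mA; rewrite setTI; apply: sub_sigma_algebra.
  have := @past_rect k A (fun=> setT) mA (fun=> measurableT).
  by rewrite (_ : \bigcap_(i in _) _ = setT) ?setIT // -subTset.
apply: (measurable_kernel mPhi (T := g_sigma_algebraType (past k)) (q := X j) (e := eps j)); first exact: (IH (ltnW jk)).
move=> _ B mB; rewrite setTI; apply: sub_sigma_algebra.
have := @past_rect k setT (fun i => if i == j then B else setT) measurableT.
rewrite preimage_setT setTI (_ : \bigcap_(i in _) _ = eps j @^-1` B).
  by apply => i; case: ifP.
apply/seteqP; split => [w /(_ j jk) /=|w /= Bw i _ /=]; first by rewrite eqxx.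
by case: eqP => [->|].
Qed.

(** Splices the realized states strictly before time [k] with a path whose own time 0 is time
    [k]. *)
Definition Xprefix k (w : Omega) (p : nat -> 'rV[R]_d) : nat -> 'rV[R]_d :=
  fun j => if (j < k)%N then X j w else p (j - k)%N.

Lemma Xprefix_pcons k w p : Xprefix k w (pcons (X k w) p) = Xprefix k.+1 w p.
Proof.
apply/funext => j; rewrite /Xprefix /pcons ltnS [(j <= k)%N]leq_eqVlt.
have [->|jk] := eqVneq j k; first by rewrite ltnn subnn.
by case: ltnP => //= kj; rewrite subn_eq0 leqNgt ltn_neqAle eq_sym jk kj /= -subnS.
Qed.

Context (F : (nat -> 'rV[R]_d) -> R) (C : R).
Hypothesis mF : mpath (fun _ : unit => F).
Hypothesis FC : forall p, `|F p| <= C.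

(** The states up to time [k] are functions of the past, hence independent of [eps k]. The fresh
    copy of [eps 0] integrated in the first step of [pathInt] may thus be replaced by the actual
    innovation, which moves the chain to its realized state at [k.+1]. *)
Lemma Markov_step k m :
  \int[P]_w pathInt P eps Phi m.+1 (fun p => F (Xprefix k w p)) (X k w) =
  \int[P]_w pathInt P eps Phi m (fun p => F (Xprefix k.+1 w p)) (X k.+1 w).
Proof.
pose h (z : g_sigma_algebraType (past k) * E) :=
  pathInt P eps Phi m (fun p => F (Xprefix k.+1 z.1 p)) (Phi (X k z.1) z.2).
have mF' : mpath (fun (z : g_sigma_algebraType (past k) * E) p =>
    F (Xprefix k.+1 z.1 p)).
  move=> dS S g q mg mq.
  rewrite (_ : (fun z => _) = (fun z => (fun _ => F) tt ((fun j z =>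
    if (j < k.+1)%N then X j (g z).1 else q (j - k.+1)%N z)^~ z))) //.
  apply: (mF (g := fun=> tt)) => // j; case: ltnP => // jk.
  have mfst : measurable_fun setT (fun z => (g z).1).
    exact: (measurableT_comp measurable_fst mg).
  exact: (measurableT_comp (@Xproc_past_measurable k j jk) mfst).
transitivity (\int[P]_w \int[P]_w' h (w, eps 0%N w')).
  apply: eq_Rintegral => w _; rewrite pathIntS; apply: eq_Rintegral => w' _.
  by rewrite /h /=; congr pathInt; apply/funext => p; rewrite Xprefix_pcons.
symmetry; apply: (@indep_Rintegral _ _ _ P _ _ (past k) (eps k) (eps 0%N)
  (@past_measurable k) (@past_setI k) (past_setT k) (meps k) (meps 0%N)
  (@past_indep k) h C).
- have mXk : measurable_fun setT (fun z : g_sigma_algebraType (past k) * E =>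
      X k z.1 : Rd d).
    exact: (measurableT_comp (@Xproc_past_measurable k k (leqnn k)) measurable_fst).
  have mk := measurable_kernel mPhi (T := (g_sigma_algebraType (past k) * E)%type)
    mXk measurable_snd.
  exact: (@pathInt_measurable R d _ _ P _ _ Phi eps mPhi (meps 0%N) m _
    (g_sigma_algebraType (past k) * E)%type _ _ C mF' (fun z p => FC _) mk).
- move=> z; exact: (@pathInt_bounded R d _ _ P _ _ Phi eps mPhi (meps 0%N) m _
    (g_sigma_algebraType (past k) * E)%type _ C mF' (fun z p => FC _) z (Phi (X k z.1) z.2)).
Qed.

(** Iterating [Markov_step] turns the integrated coordinates into realized ones, from none to all.
    The [minn j t] reflects that [pathInt] prolongs a path by its last state. *)
Lemma Rintegral_Xproc t :
  \int[P]_w F (fun j => X (minn j t) w) = \int[P]_w pathInt P eps Phi t F (X0 w).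
Proof.
have -> : \int[P]_w pathInt P eps Phi t F (X0 w) =
    \int[P]_w pathInt P eps Phi t (fun p => F (Xprefix 0 w p)) (X 0 w).
  apply: eq_Rintegral => w _; congr pathInt; apply/funext => p; congr F.
  by apply/funext => j; rewrite /Xprefix /= subn0.
suff H k : (k <= t)%N ->
    \int[P]_w pathInt P eps Phi t (fun p => F (Xprefix 0 w p)) (X 0 w) =
    \int[P]_w pathInt P eps Phi (t - k) (fun p => F (Xprefix k w p)) (X k w).
  rewrite (H t) // subnn; apply: eq_Rintegral => w _ /=; congr F.
  by apply/funext => j; rewrite /Xprefix; case: ltnP => jt; rewrite ?(minn_idPr jt) ?(minn_idPl (ltnW jt)).
elim: k => [|k IH kt]; first by rewrite subn0.
by rewrite (IH (ltnW kt)) -(subnSK kt); exact: Markov_step.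
Qed.

End markov_property.

(** * Euclidean norm and scaling of the kernel *)

Section euclidean_norm.
Context {R : realType} {d : nat}.
Implicit Types v : 'rV[R]_d.

Lemma enorm_ge0 v : 0 <= enorm v.
Proof. exact: sqrtr_ge0. Qed.

Lemma normr_coord_le_enorm v i : `|v ord0 i| <= enorm v.
Proof.
rewrite -sqrtr_sqr; apply: ler_wsqrtr; rewrite (bigD1 i) //= lerDl.
by apply: sumr_ge0 => j _; exact: sqr_ge0.
Qed.

Lemma normr_le_enorm v : `|v| <= enorm v.
Proof.
rewrite [`|v|]mx_normrE; apply: bigmax_le; first exact: enorm_ge0.
by move=> [i j] _ /=; rewrite (ord1 i); exact: normr_coord_le_enorm.
Qed.

Lemma enormZ (c : R) v : enorm (c *: v) = `|c| * enorm v.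
Proof.
rewrite /enorm -sqrtr_sqr -sqrtrM ?sqr_ge0 // mulr_sumr; congr Num.sqrt.
by apply: eq_bigr => i _; rewrite mxE exprMn.
Qed.

Lemma enorm0 : enorm (0 : 'rV[R]_d) = 0.
Proof. by rewrite -[0](scale0r (0 : 'rV[R]_d)) enormZ normr0 mul0r. Qed.

Lemma enorm_eq0 v : (enorm v == 0) = (v == 0).
Proof.
apply/eqP/eqP => [v0|->]; last exact: enorm0.
by apply/eqP; rewrite -normr_eq0 eq_le normr_ge0 andbT -v0 normr_le_enorm.
Qed.

Lemma enorm_gt0 v : (0 < enorm v) = (v != 0).
Proof. by rewrite lt_neqAle enorm_ge0 andbT eq_sym enorm_eq0. Qed.

Lemma sphere_normalize v : v != 0 -> sphere d ((enorm v)^-1 *: v).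
Proof.
move=> v0; have e0 : 0 < enorm v by rewrite enorm_gt0.
by rewrite /sphere /= enormZ gtr0_norm ?invr_gt0 // mulVf // gt_eqF.
Qed.

Lemma sphere_neq0 v : sphere d v -> v != 0.
Proof. by rewrite /sphere /= -enorm_eq0 => ->; rewrite oner_eq0. Qed.

Lemma normalizeK v : enorm v *: ((enorm v)^-1 *: v) = v.
Proof.
have [->|v0] := eqVneq v 0; first by rewrite !scaler0.
by rewrite scalerA mulfV ?scale1r // enorm_eq0.
Qed.

Lemma enorm_cvg T (F : set_system T) {FF : Filter F} (f : T -> 'rV[R]_d) v :
  f x @[x --> F] --> v -> enorm (f x) @[x --> F] --> enorm v.
Proof.
move=> fv; apply: (@continuous_cvg _ _ _ _ _ _ Num.sqrt); first exact: sqrt_continuous.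
apply: cvg_big => [|i _]; first exact: add_continuous.
have fi : f x ord0 i @[x --> F] --> v ord0 i.
  exact: (continuous_cvg _ (@coord_continuous _ _ _ ord0 i v) fv).
by rewrite expr2; apply: cvg_trans (cvgM fi fi); apply: near_eq_cvg; apply: nearW.
Qed.

Lemma enorm_continuous : continuous (@enorm R d).
Proof. by move=> v; apply: (@enorm_cvg _ (nbhs (v : 'rV[R]_d)) _ id). Qed.

Lemma sphere_closed : closed (@sphere R d).
Proof.
have -> : @sphere R d = @enorm R d @^-1` [set 1] by [].
apply: closed_comp => [v _|]; first exact: enorm_continuous.
exact: closed_eq.
Qed.

Lemma sphere_compact : compact (@sphere R d).
Proof.
apply: bounded_closed_compact; last exact: sphere_closed.
exists 1; split => [|M M1 v /= v1]; first exact: num_real.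
by rewrite (le_trans (normr_le_enorm v)) // v1 ltW.
Qed.

Lemma measurable_enorm : measurable_fun setT (@enorm R d : Rd d -> R).
Proof.
have msqrt : measurable_fun setT (Num.sqrt : R -> R).
  by apply: continuous_measurable_fun; exact: sqrt_continuous.
apply: (measurableT_comp msqrt (g := fun v : Rd d => \sum_(i < d) (v : 'rV[R]_d) ord0 i ^+ 2)).
apply: measurable_sum => i; apply: measurable_funX.
by apply: (measurable_fun_RdP (T := Rd d) id).1; exact: measurable_id.
Qed.

Lemma measurable_scale {dT} {T : measurableType dT} (a : T -> R) (q : T -> 'rV[R]_d) :
  measurable_fun setT a -> measurable_fun setT (q : T -> Rd d) ->
  measurable_fun setT (fun z => a z *: q z : Rd d).
Proof.
move=> ma /measurable_fun_RdP mq; apply/measurable_fun_RdP => i.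
rewrite (_ : (fun z => _) = (fun z => a z * q z ord0 i)).
  exact: measurable_funM.
by apply/funext => z; rewrite mxE.
Qed.

Lemma measurable_enorm_comp {dT} {T : measurableType dT} (q : T -> 'rV[R]_d) :
  measurable_fun setT (q : T -> Rd d) -> measurable_fun setT (fun z => enorm (q z)).
Proof. exact: measurableT_comp measurable_enorm. Qed.

Lemma measurable_normalize {dT} {T : measurableType dT} (q p : T -> 'rV[R]_d) :
  measurable_fun setT (q : T -> Rd d) -> measurable_fun setT (p : T -> Rd d) ->
  measurable_fun setT (fun z => (enorm (q z))^-1 *: p z : Rd d).
Proof.
move=> mq; apply: measurable_scale.
(* As a power the inverse is measurable on the whole line; at 0 both expressions equal 0. *)
rewrite (_ : (fun z => _) = (fun z => enorm (q z) `^ (- 1))).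
  exact: (measurableT_comp (measurable_powR _) (measurable_enorm_comp mq)).
by apply/funext => z; rewrite powR_inv1 ?enorm_ge0.
Qed.

(** Measurability of [phi] is known on the sphere only. Truncating it to 0 elsewhere gives a
    globally measurable [psi], and normalization feeds it only points of the sphere, except at 0,
    where the factor [enorm] vanishes. *)
Lemma measurable_phi_ext {dE} {E : measurableType dE} (phi : 'rV[R]_d -> E -> 'rV[R]_d) :
  measurable_fun [set z : Rd d * E | sphere d z.1]
    (fun z : Rd d * E => (phi z.1 z.2 : Rd d)) ->
  measurable_fun [set: Rd d * E] (fun z => (phi_ext phi z.1 z.2 : Rd d)).
Proof.
move=> mphi.
have me : measurable_fun setT (fun z : Rd d * E => enorm (z.1 : 'rV[R]_d)).
  exact: (measurableT_comp measurable_enorm measurable_fst).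
pose psi (v : 'rV[R]_d) e : 'rV[R]_d := if enorm v == 1 then phi v e else 0.
have mpsi : measurable_fun setT (fun z : Rd d * E => psi z.1 z.2 : Rd d).
  apply: measurable_fun_if => //; first exact: measurable_fun_eqr.
  rewrite setTI (_ : _ @^-1` _ = [set z : Rd d * E | sphere d z.1]) //.
  by apply/seteqP; split => z /= /eqP.
pose nrm (z : Rd d * E) : Rd d := (enorm (z.1 : 'rV[R]_d))^-1 *: (z.1 : 'rV[R]_d).
have mn : measurable_fun setT (fun z => (nrm z, z.2)).
  apply/measurable_fun_pairP; split; last exact: measurable_snd.
  apply: measurable_normalize; exact: measurable_fst.
have mg : measurable_fun setT (fun z : Rd d * E =>
    enorm (z.1 : 'rV[R]_d) *: psi (nrm z) z.2 : Rd d).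
  apply: (measurable_scale me).
  exact: (measurableT_comp mpsi mn).
apply: eq_measurable_fun mg => z _; rewrite /phi_ext /psi /nrm.
have [->|v0] := eqVneq (z.1 : 'rV[R]_d) 0; first by rewrite enorm0 scale0r.
by have -> := sphere_normalize v0; rewrite eqxx.
Qed.

Lemma cvg_mxP T (F : set_system T) {FF : Filter F} m n (f : T -> 'M[R]_(m, n)) (M : 'M[R]_(m, n)) :
  (forall i j, f x i j @[x --> F] --> M i j) -> f x @[x --> F] --> M.
Proof.
move=> h; apply/cvg_ballP => e e0.
have : \forall x \near F, forall ij : 'I_m * 'I_n, ball (M ij.1 ij.2) e (f x ij.1 ij.2).
  by apply: filter_forall => -[i j] /=; have /cvg_ballP := h i j; apply.
by apply: filterS => x hx; split => // i j; exact: (hx (i, j)).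
Qed.

End euclidean_norm.

(** * Convergence of the rescaled kernel along sequences *)

Section kernel_scaling.
Context {R : realType} {d : nat} {E : Type}.
Context (Phi phi : 'rV[R]_d -> E -> 'rV[R]_d).
Hypothesis Phi_phi : forall (e : E) (s : 'rV[R]_d) (sx : R -> 'rV[R]_d),
  sphere d s -> (forall x, sphere d (sx x)) ->
  sx x @[x --> +oo] --> s ->
  (x^-1 *: Phi (x *: sx x) e) @[x --> +oo] --> phi s e.

(* If the convergence failed, then at each radius [x] having a failing index,
   pick the direction of such an index: this path converges to [s] and still
   fails at arbitrarily large radii. *)
Lemma Phi_phi_seq (e : E) (s : 'rV[R]_d) (r_ : nat -> R) (s_ : nat -> 'rV[R]_d) :
  sphere d s -> (forall n, sphere d (s_ n)) ->
  r_ n @[n --> \oo] --> +oo -> s_ n @[n --> \oo] --> s ->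
  ((r_ n)^-1 *: Phi (r_ n *: s_ n) e) @[n --> \oo] --> phi s e.
Proof.
move=> Ss Ss_ r_oo s_s; apply/cvg_ballP => e0 e00.
pose bad x s' := ~ ball (phi s e) e0 (x^-1 *: Phi (x *: s') e).
pose B x := [set s' | exists n, [/\ s' = s_ n, r_ n = x & bad x s']].
pose sx x := xget s (B x).
have Bsx x : B x (sx x) \/ sx x = s.
  by rewrite /sx; case: xgetP => [y _ By|_]; [left|right].
have Ssx x : sphere d (sx x) by case: (Bsx x) => [[n [-> _ _]]|->].
have sxs : sx x @[x --> +oo] --> s.
  apply/cvg_ballP => e1 e10.
  have [N _ hN] : \forall n \near \oo, ball s e1 (s_ n) by have /cvg_ballP := s_s; apply.
  (* A failing index whose radius exceeds [M] must be at least [N], where [s_] is already close to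
     [s]. *)
  pose M := \big[Num.max/0]_(i < N) r_ i.
  near=> x; case: (Bsx x) => [[n [-> rn _]]|->]; last exact: ballxx.
  apply: hN => /=; rewrite leqNgt; apply/negP => nN.
  have : x <= M by rewrite -rn /M; exact: (le_bigmax 0 (fun i : 'I_N => r_ i) (Ordinal nN)).
  by apply/negP; rewrite -ltNge; near: x; exact: nbhs_pinfty_gt (num_real _).
have /cvg_ballP /(_ _ e00) good := @Phi_phi e _ _ Ss Ssx sxs.
have : \forall n \near \oo, ball (phi s e) e0 ((r_ n)^-1 *: Phi (r_ n *: sx (r_ n)) e).
  exact: (r_oo _ good).
apply: filterS => n good_n; apply: contrapT => bad_n.
have : B (r_ n) (sx (r_ n)).
  by rewrite /sx; case: xgetP => [//|/(_ (s_ n))[]]; exists n.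
by move=> [_ [_ _]].
Unshelve. all: by end_near. Qed.

(** In polar form the argument has radius [r_ n * enorm (m_ n)], which diverges because [m] is
    nonzero, and a convergent direction. Multiplying the resulting limit by [enorm (m_ n)] restores
    the normalization by [r_ n]. *)
Lemma kernel_cvg_neq0 (e : E) (m : 'rV[R]_d) (r_ : nat -> R) (m_ : nat -> 'rV[R]_d) :
  m != 0 -> r_ n @[n --> \oo] --> +oo -> m_ n @[n --> \oo] --> m ->
  ((r_ n)^-1 *: Phi (r_ n *: m_ n) e) @[n --> \oo] --> phi_ext phi m e.
Proof.
move=> m0 r_oo m_m; rewrite /phi_ext (negbTE m0).
have em0 : 0 < enorm m by rewrite enorm_gt0.
have em_m : enorm (m_ n) @[n --> \oo] --> enorm m by exact: enorm_cvg.
pose s := (enorm m)^-1 *: m.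
(* The default [s] keeps every term on the sphere; it occurs for finitely many [n] only. *)
pose s_ n := if m_ n == 0 then s else (enorm (m_ n))^-1 *: m_ n.
have m_n0 : \forall n \near \oo, 0 < enorm (m_ n) by exact: (@cvgr_gt _ _ _ _ _ _ em_m _ em0).
have Ss_ n : sphere d (s_ n).
  by rewrite /s_; case: eqVneq => [_|]; exact: sphere_normalize.
have s_s : s_ n @[n --> \oo] --> s.
  have : (enorm (m_ n))^-1 *: m_ n @[n --> \oo] --> s.
    by apply: cvgZ => //; apply: cvgV => //; rewrite gt_eqF.
  apply: cvg_trans; apply: near_eq_cvg; near=> n; rewrite /s_.
  rewrite ifF //; apply/negbTE; rewrite -enorm_gt0; near: n; exact: m_n0.
have rm_oo : r_ n * enorm (m_ n) @[n --> \oo] --> +oo.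
  have c0 : 0 < enorm m / 2 by rewrite divr_gt0.
  have c1 : \forall n \near \oo, enorm m / 2 < enorm (m_ n).
    by apply: (@cvgr_gt _ _ _ _ _ _ em_m); rewrite ltr_pdivrMr // ltr_pMr // ltr1n.
  apply/cvgryPge => A; near=> n.
  have rA : `|A| / (enorm m / 2) < r_ n by near: n; exact: cvgry_gt r_oo _.
  have r0 : 0 < r_ n by apply: le_lt_trans rA; rewrite divr_ge0 // ltW.
  have cn : enorm m / 2 < enorm (m_ n) by near: n.
  rewrite (le_trans (ler_norm A)) // (@le_trans _ _ (r_ n * (enorm m / 2))) //.
    by rewrite -ler_pdivrMr // ltW.
  by rewrite ler_pM2l // ltW.
have := Phi_phi_seq (e := e) (sphere_normalize m0) Ss_ rm_oo s_s.
move=> /(cvgZ em_m); apply: cvg_trans; apply: near_eq_cvg; near=> n.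
have mn0 : 0 < enorm (m_ n) by near: n; exact: m_n0.
have mne : m_ n != 0 by rewrite -enorm_gt0.
rewrite /s_ (negbTE mne) scalerA invfM mulrCA mulfV ?gt_eqF // mulr1.
by rewrite -(scalerA (r_ n)) normalizeK.
Unshelve. all: by end_near. Qed.

Lemma kernel_cvg_0 (e : E) (C x0 : R) (r_ : nat -> R) (m_ : nat -> 'rV[R]_d) :
  (forall x, x0 <= x -> forall y : 'rV[R]_d, enorm y <= x -> enorm (Phi y e) <= C * x) ->
  r_ n @[n --> \oo] --> +oo -> m_ n @[n --> \oo] --> (0 : 'rV[R]_d) ->
  ((r_ n)^-1 *: Phi (r_ n *: m_ n) e) @[n --> \oo] --> phi_ext phi 0 e.
Proof.
move=> hC r_oo m_0; rewrite /phi_ext eqxx.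
have rV : (r_ n)^-1 @[n --> \oo] --> (0 : R).
  by apply/gtr0_cvgV0 => //; exact: (cvgry_gt r_oo).
(* This is the growth bound at [x = r_ n * enorm (m_ n) + |x0|], divided by [r_ n]. The summand |x0|
   ensures [x0 <= x], since [r_ n * enorm (m_ n)] may stay bounded. *)
have b0 : C * (enorm (m_ n) + `|x0| * (r_ n)^-1) @[n --> \oo] --> (0 : R).
  rewrite -(mulr0 C) -[X in C * X](addr0 0) -[in X in C * (_ + X)](mulr0 `|x0|).
  apply: cvgM; first exact: cvg_cst.
  apply: cvgD; last by apply: cvgM => //; exact: cvg_cst.
  by rewrite -(@enorm0 R d); exact: enorm_cvg.
apply: norm_cvg0.
apply: (squeeze_cvgr _ (cvg_cst 0) b0).
near=> n; rewrite normr_ge0 /=.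
have rn : 0 < r_ n by near: n; exact: cvgry_gt r_oo _.
rewrite (le_trans (normr_le_enorm _)) // enormZ gtr0_norm ?invr_gt0 //.
rewrite ler_pdivrMl // mulrCA mulrDr [r_ n * (_ * _)]mulrCA mulfV ?gt_eqF // mulr1.
apply: hC; first by rewrite (le_trans (ler_norm x0)) // lerDr mulr_ge0 ?enorm_ge0 // ltW.
by rewrite enormZ gtr0_norm // lerDl.
Unshelve. all: by end_near. Qed.

End kernel_scaling.

(** * Continuous convergence of iterated integrals *)

Section pathInt_convergence.
Context {R : realType} {d : nat}.
Context {dO} {Omega : measurableType dO} (P : probability Omega R).
Context {dE} {E : measurableType dE} (eps : nat -> Omega -> E).
Implicit Types phi : 'rV[R]_d -> E -> 'rV[R]_d.

Lemma eq_pathInt phi k (F F' : (nat -> 'rV[R]_d) -> R) (m : 'rV[R]_d) :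
  (forall p, p 0%N = m -> F p = F' p) ->
  pathInt P eps phi k F m = pathInt P eps phi k F' m.
Proof.
case: k => [|k] FF'; first exact: FF'.
rewrite !pathIntS; apply: eq_Rintegral => w _; congr (pathInt _ _ _ _ _ _).
by apply/funext => p; exact: FF'.
Qed.

(** Moves the scale from the initial state into the kernel, which becomes the rescaled kernel known
    to converge. *)
Lemma pathInt_scale phi k (F : (nat -> 'rV[R]_d) -> R) (r : R) (s : 'rV[R]_d) : r != 0 ->
  pathInt P eps phi k F (r *: s) =
  pathInt P eps (fun m e => r^-1 *: phi (r *: m) e) k
    (fun p => F (fun j => r *: p j)) s.
Proof.
move=> r0; elim: k F s => [//|k IH] F s.
rewrite !pathIntS; apply: eq_Rintegral => w _.
transitivity (pathInt P eps phi k (fun p => F (pcons (r *: s) p))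
    (r *: (r^-1 *: phi (r *: s) (eps 0%N w)))).
  by rewrite scalerA mulfV // scale1r.
rewrite IH.
congr (pathInt _ _ _ _ _ _); apply/funext => p; congr F; apply/funext => j.
by rewrite /pcons; case: ifP.
Qed.

Hypothesis meps : measurable_fun setT (eps 0%N).

Lemma mpath_cst {dT} {T : measurableType dT} (F : (nat -> 'rV[R]_d) -> R) :
  mpath (fun _ : unit => F) -> mpath (fun _ : T => F).
Proof. by move=> mF; apply: (mpath_comp mF (h := fun=> tt)). Qed.

(** Induction on the number of steps with bounded convergence in the innovation. Functional and
    starting point both vary with [n], because one step prepends [m_ n] to the path and restarts
    from a random state. The set [D] holds the states at which the kernels converge, and the limit
    chain almost surely stays in it. *)
Lemma pathInt_cvg (phi_ : nat -> 'rV[R]_d -> E -> 'rV[R]_d) phi (D : set 'rV[R]_d) (C : R) :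
  (forall n, measurable_fun [set: Rd d * E] (fun z => (phi_ n z.1 z.2 : Rd d))) ->
  measurable_fun [set: Rd d * E] (fun z => (phi z.1 z.2 : Rd d)) ->
  (forall m, D m -> {ae P, forall w, D (phi m (eps 0%N w))}) ->
  (forall (m : 'rV[R]_d) (m_ : nat -> 'rV[R]_d), D m -> m_ n @[n --> \oo] --> m ->
    {ae P, forall w, phi_ n (m_ n) (eps 0%N w) @[n --> \oo] --> phi m (eps 0%N w)}) ->
  forall k (F_ : nat -> (nat -> 'rV[R]_d) -> R) (F : (nat -> 'rV[R]_d) -> R)
    (m : 'rV[R]_d) (m_ : nat -> 'rV[R]_d),
  (forall n, mpath (fun _ : unit => F_ n)) -> mpath (fun _ : unit => F) ->
  (forall n p, `|F_ n p| <= C) -> (forall p, `|F p| <= C) ->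
  (forall (p : nat -> 'rV[R]_d) (p_ : nat -> nat -> 'rV[R]_d),
     (forall j, p_ n j @[n --> \oo] --> p j) -> F_ n (p_ n) @[n --> \oo] --> F p) ->
  D m -> m_ n @[n --> \oo] --> m ->
  pathInt P eps (phi_ n) k (F_ n) (m_ n) @[n --> \oo] --> pathInt P eps phi k F m.
Proof.
move=> mphi_ mphi phiD phi_phi.
elim=> [|k IH] F_ F m m_ mF_ mF FC_ FC FF Dm m_m /=; first exact: FF.
have mpc (G : (nat -> 'rV[R]_d) -> R) (v : 'rV[R]_d) : mpath (fun _ : unit => G) ->
    mpath (fun _ : unit => (fun p => G (pcons v p))).
  by move=> mG; exact: (mpath_pcons (q := fun=> v) mG).
have mpI psi (G : (nat -> 'rV[R]_d) -> R) (v : 'rV[R]_d) :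
    measurable_fun [set: Rd d * E] (fun z => (psi z.1 z.2 : Rd d)) ->
    (forall p, `|G p| <= C) -> mpath (fun _ : unit => G) ->
    measurable_fun setT (fun w => pathInt P eps psi k (fun p => G (pcons v p)) (psi v (eps 0%N w))).
  move=> mpsi GC mG.
  have mq := measurable_kernel mpsi (q := fun=> v : Rd d) (measurable_cst _) meps.
  exact: (@pathInt_measurable R d _ _ P _ _ psi eps mpsi meps k _ _
    (fun _ p => G (pcons v p)) _ C (mpath_cst (mpc _ v mG)) (fun _ p => GC _) mq).
apply: (@bounded_cvg_Rintegral _ _ _ P _ _ C).
- by move=> n; apply: mpI.
- exact: mpI.
- by move=> n w; exact: (@pathInt_bounded R d _ _ P _ _ (phi_ n) eps (mphi_ n) meps k _ _
    (fun _ p => F_ n (pcons (m_ n) p)) C (mpc _ (m_ n) (mF_ n)) (fun _ p => FC_ n _) tt).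
have := phi_phi _ _ Dm m_m; have := phiD _ Dm.
apply: filterS2 => w Dw cw; apply: IH => //.
- by move=> n; exact: mpc.
- exact: mpc.
- move=> p p_ pp; apply: FF => -[|j] //=; exact: pp.
Qed.

End pathInt_convergence.

(** * From continuous convergence to uniform convergence on compact sets *)

Section locally_uniform_convergence.
Context {R : realType}.

(** Otherwise each [n] has a counterexample with radius beyond [n] within [n.+1%:R^-1] of [z], and
    these form a forbidden sequence. *)
Lemma seq_nbhs_pinfty {V : pseudoMetricType R} (z : V) (Q : R -> V -> Prop) :
  (forall (r_ : nat -> R) (z_ : nat -> V), r_ n @[n --> \oo] --> +oo ->
     z_ n @[n --> \oo] --> z -> \forall n \near \oo, Q (r_ n) (z_ n)) ->
  exists e : R, 0 < e /\ exists M : R, forall r z', M < r -> ball z e z' -> Q r z'.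
Proof.
move=> H; apply: contrapT => notQ.
have bad n : exists rz : R * V, [/\ n%:R < rz.1, ball z n.+1%:R^-1 rz.2 & ~ Q rz.1 rz.2].
  apply: contrapT => nbad; apply: notQ; exists n.+1%:R^-1; split => //.
  exists n%:R => r z' nr bz'; apply: contrapT => nQ; apply: nbad.
  by exists (r, z').
have [rz hrz] := choice bad.
have roo : (rz n).1 @[n --> \oo] --> +oo.
  apply/cvgryPgt => A; have : \forall n \near \oo, A < n%:R by exact: nbhs_infty_gtr.
  by apply: filterS => n An; have [+ _ _] := hrz n; exact: lt_trans.
have zz : (rz n).2 @[n --> \oo] --> z.
  apply/cvg_ballP => e e0; have := near_infty_natSinv_lt (PosNum e0).
  by apply: filterS => n /= ne; have [_ + _] := hrz n; apply: le_ball; exact: ltW.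
have [N _ /(_ N (leqnn N))] := H _ _ roo zz.
by have [_ _] := hrz N.
Qed.

Context {V : pseudoMetricType R} (S : set V) (u : R -> R -> V -> R) (g : R -> V -> R).
Hypothesis ug : forall (r_ y_ : nat -> R) (s_ : nat -> V) y s,
  r_ n @[n --> \oo] --> +oo -> y_ n @[n --> \oo] --> y -> s_ n @[n --> \oo] --> s ->
  S s -> (forall n, S (s_ n)) -> u (r_ n) (y_ n) (s_ n) @[n --> \oo] --> g y s.

Lemma continuous_convergence_near (eta y : R) (s : V) : 0 < eta -> S s ->
  exists e : R, 0 < e /\ exists M : R, forall y' s', S s' -> ball (y, s) e (y', s') ->
    (forall r, M < r -> `|u r y' s' - g y s| <= eta) /\ `|g y' s' - g y s| <= eta.
Proof.
move=> eta0 Ss.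
have [r_ z_ roo zz|e [e0 [M hM]]] := @seq_nbhs_pinfty (R * V)%type (y, s)
    (fun r z => S z.2 -> `|u r z.1 z.2 - g y s| <= eta).
  (* Points outside [S] are replaced by the limit [s], so that [ug] applies; the claim at those
     indices is vacuous. *)
  pose s_ n := if pselect (S (z_ n).2) then (z_ n).2 else s.
  have z1 : (z_ n).1 @[n --> \oo] --> y by apply: (cvg_comp _ _ zz cvg_fst).
  have z2 : (z_ n).2 @[n --> \oo] --> s by apply: (cvg_comp _ _ zz cvg_snd).
  have Ss_ n : S (s_ n) by rewrite /s_; case: pselect.
  have ss : s_ n @[n --> \oo] --> s.
    apply/cvg_ballP => e e0; have /cvg_ballP /(_ _ e0) := z2; apply: filterS => n.
    by rewrite /s_; case: pselect => [//|nS _]; exact: ballxx.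
  have /cvgrPdist_le /(_ _ eta0) := ug roo z1 ss Ss Ss_.
  by apply: filterS => n; rewrite /s_ distrC /=; case: pselect.
exists e; split => //; exists M => y' s' Ss' bz; split => [r Mr|].
  exact: (hM r (y', s')).
(* Letting the radius diverge at a fixed point [(y', s')] transfers the bound to [g], so continuity
   of the limit follows from continuous convergence alone. *)
have hn : \forall n \near \oo, `|u n%:R y' s' - g y s| <= eta.
  near=> n; apply: (hM _ (y', s')) => //.
  by near: n; exact: nbhs_infty_gtr.
have cn : `|u n%:R y' s' - g y s| @[n --> \oo] --> `|g y' s' - g y s|.
  apply: cvg_norm; apply: cvgB; last exact: cvg_cst.
  by apply: ug => //; [exact: cvgr_idn | exact: cvg_cst | exact: cvg_cst].
rewrite -(cvg_lim _ cn) //; apply: limr_le hn.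
by apply/cvg_ex; eexists; exact: cn.
Unshelve. all: by end_near. Qed.

Lemma continuous_convergence_uniform (B eta : R) : compact S -> 0 < eta ->
  exists delta, 0 < delta /\ exists M, forall r y y' s, 1 <= y <= B -> S s ->
    `|y - y'| < delta -> (M < r -> `|u r y s - g y' s| <= eta) /\ `|g y s - g y' s| <= eta.
Proof.
move=> cS eta0.
have e20 : 0 < eta / 2 by rewrite divr_gt0.
have loc y s (Ss : S s) := continuous_convergence_near y e20 Ss.
(* A single parameter [M] is both the threshold for the radius and, through its inverse, the modulus
   in [y]; a near-covering argument along [+oo] then gives both at once. *)
pose Q (M : R) (z : R * V) := S z.2 -> forall y', `|z.1 - y'| < M^-1 ->
  (forall r, M < r -> `|u r z.1 z.2 - g y' z.2| <= eta) /\ `|g z.1 z.2 - g y' z.2| <= eta.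
have cK : compact (`[1, B]%classic `*` S).
  by apply: compact_setX => //; exact: segment_compact.
have /compact_near_coveringP := cK.
move=> /(_ R (pinfty_nbhs R) Q _) [|M0 [_ hM0]].
  move=> [y s] [_ /= Ss]; have [e [e0 [M hM]]] := loc y s Ss.
  have e2 : 0 < e / 2 by rewrite divr_gt0.
  (* Half of the radius is reserved for the displacement from [y1] to [y2], which is less than
     [N^-1 < e / 2]. *)
  exists (ball (y, s) (e / 2), [set N : R | Num.max (e / 2)^-1 M < N]).
    split; first exact: nbhsx_ballx.
    by exists (Num.max (e / 2)^-1 M); split; [exact: num_real|].
  move=> [[y1 s1] N] [/= [b1 b2]]; rewrite gt_max => /andP[Ne NM] Ss1 y2 /= yy.
  have N0 : 0 < N by apply: lt_trans Ne; rewrite invr_gt0.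
  have bz1 : ball (y, s) e (y1, s1).
    have : ball (y, s) (e / 2) (y1, s1) by split.
    by apply: le_ball; rewrite ler_pdivrMr // ler_pMr // ler1n.
  have bz2 : ball (y, s) e (y2, s1).
    split => /=; last exact: bz1.2.
    rewrite /ball /= in b1 *.
    have : N^-1 < e / 2 by rewrite -[e / 2]invrK ltf_pV2 // posrE ?invr_gt0.
    move: b1 yy; rewrite !ltr_norml; lra.
  have [u1 g1] := hM _ _ Ss1 bz1; have [_ g2] := hM _ _ Ss1 bz2.
  split => [r Nr|].
    have := u1 r (lt_trans NM Nr); move: g2; rewrite !ler_norml; lra.
  by move: g1 g2; rewrite !ler_norml; lra.
pose M := Num.max M0 0 + 1.
have MM0 : M0 < M by rewrite /M (@le_lt_trans _ _ (Num.max M0 0)) ?ltrDl // le_max lexx.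
have M_gt0 : 0 < M by rewrite /M (@le_lt_trans _ _ (Num.max M0 0)) ?ltrDl // le_max lexx orbT.
exists M^-1; split; first by rewrite invr_gt0.
exists M => r y y' s yB Ss yy.
have [] := hM0 M MM0 (y, s) _ Ss y' yy.
  by split => //=; rewrite in_itv.
by move=> h1 h2; split => // Mr; exact: h1.
Qed.

End locally_uniform_convergence.

(* For [y > u_ 0], the function [f] is compared with the step function equal to
   [a_ k] on [`]u_ k, u_ k.+1]] for [k < N] and to [0] beyond [u_ N]. *)
Lemma step_approx {R : realType} (f : R -> R) (u_ a_ : nat -> R) (N : nat) (eta C y : R) :
  {homo u_ : m n / (m <= n)%N >-> m <= n} -> 0 <= eta ->
  (forall k, (k < N)%N -> u_ k < y <= u_ k.+1 -> `|f y - a_ k| <= eta) ->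
  `|f y| <= C -> u_ 0%N < y ->
  `|f y - \sum_(k < N) ((u_ k < y)%R%:R - (u_ k.+1 < y)%R%:R) * a_ k| <=
    eta + C * (u_ N < y)%R%:R.
Proof.
move=> umono eta0 fa fC u0y.
suff : if u_ N < y then \sum_(k < N) ((u_ k < y)%R%:R - (u_ k.+1 < y)%R%:R) * a_ k = 0
       else `|f y - \sum_(k < N) ((u_ k < y)%R%:R - (u_ k.+1 < y)%R%:R) * a_ k| <= eta.
  case: ifP => [uN ->|uN]; last by rewrite mulr0 addr0.
  by rewrite subr0 mulr1 (le_trans fC) // lerDr.
elim: N fa => [|N IH] fa; first by rewrite u0y big_ord0.
have {}IH := IH (fun k kN => fa k (ltnW kN)).
rewrite big_ord_recr /=; case: ifP => [uN1|uN1].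
  have uN : u_ N < y by rewrite (le_lt_trans _ uN1) // umono.
  by move: IH; rewrite ?uN ?uN1 => ->; rewrite subrr mul0r addr0.
case: ifP IH => [uN ->|uN IH]; rewrite ?uN ?uN1.
  by rewrite add0r subr0 mul1r; apply: fa => //; rewrite uN leNgt uN1.
by rewrite subrr mul0r addr0.
Qed.

(** * Fubini and the layer-cake formula *)

Lemma normr_indic_le1 {R : realType} {T : Type} (A : set T) (x : T) :
  `|\1_A x| <= 1 :> R.
Proof. by rewrite indicE; case: (_ \in _); rewrite ?normr1 ?normr0. Qed.

Section bounded_fubini.
Context {R : realType} {d1 d2} {T1 : measurableType d1} {T2 : measurableType d2}.
Context (Q1 : probability T1 R) (Q2 : probability T2 R).

Lemma EFin_Rintegral_bounded (f : T1 -> R) (C : R) :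
  measurable_fun setT f -> (forall x, `|f x| <= C) ->
  (\int[Q1]_x (f x)%:E)%E = (\int[Q1]_x f x)%:E.
Proof.
move=> mf fC; rewrite /Rintegral fineK //; apply: integrable_fin_num => //.
exact: (integrable_bounded Q1 mf fC).
Qed.

Lemma Rintegral_indic (A : set T1) : measurable A -> \int[Q1]_x \1_A x = fine (Q1 A).
Proof. by move=> mA; rewrite /Rintegral integral_indic // setIT. Qed.

Lemma Rintegral_ae_eq0 (f : T1 -> R) (C : R) :
  measurable_fun setT f -> (forall x, 0 <= f x <= C) -> \int[Q1]_x f x = 0 ->
  {ae Q1, forall x, f x = 0}.
Proof.
move=> mf f0C If0.
have /(ae_eq_integral_abs Q1 measurableT (f := EFin \o f)) :
    measurable_fun setT (EFin \o f) by exact/measurable_EFinP.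
case=> [+ _]; rewrite (eq_integral (fun x => (f x)%:E)); last first.
  by move=> x _ /=; rewrite ger0_norm //; case/andP: (f0C x).
rewrite (@EFin_Rintegral_bounded f C) // ?If0; last first.
  by move=> x; case/andP: (f0C x) => f0 fC; rewrite ger0_norm.
by move=> /(_ erefl); apply: filterS => x /(_ I) [].
Qed.

End bounded_fubini.

Section bounded_fubini_swap.
Context {R : realType} {d1 d2} {T1 : measurableType d1} {T2 : measurableType d2}.
Context (Q1 : probability T1 R) (Q2 : probability T2 R).

Lemma Rintegral_swap (h : T1 * T2 -> R) (C : R) :
  measurable_fun setT h -> (forall z, `|h z| <= C) ->
  \int[Q1]_x \int[Q2]_y h (x, y) = \int[Q2]_y \int[Q1]_x h (x, y).
Proof.
move=> mh hC.
have mhE : measurable_fun setT (EFin \o h) by apply/measurable_EFinP.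
have Ih : (Q1 \x Q2)%E.-integrable setT (EFin \o h).
  apply: measurable_bounded_integrable => //.
    have e : (Q1 \x Q2)%E (setT `*` setT) = (Q1 setT * Q2 setT)%E.
      exact: product_measure1E.
    rewrite setXTT in e; apply: (@le_lt_trans _ _ (1 * 1)%E); last by rewrite mule1 ltry.
    apply: (eq_ind_r (fun x => x <= _)%E _ e).
    by apply: lee_pmul => //; exact: probability_le1.
  exists C; split; first exact: num_real.
  by move=> M CM x _; exact: (le_trans (hC x) (ltW CM)).
have e1 x : measurable_fun setT (fun y => h (x, y)).
  exact: (measurableT_comp mh (pair1_measurable x)).
have e2 y : measurable_fun setT (fun x => h (x, y)).
  exact: (measurableT_comp mh (pair2_measurable y)).
have h1 x : (\int[Q2]_y h (x, y))%:E = (\int[Q2]_y (h (x, y))%:E)%E.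
  by rewrite (EFin_Rintegral_bounded Q2 (e1 x) (fun y => hC (x, y))).
have h2 y : (\int[Q1]_x h (x, y))%:E = (\int[Q1]_x (h (x, y))%:E)%E.
  by rewrite (EFin_Rintegral_bounded Q1 (e2 y) (fun x => hC (x, y))).
rewrite {1}/Rintegral [RHS]/Rintegral; congr fine.
under eq_integral => x _ do rewrite h1.
under [RHS]eq_integral => y _ do rewrite h2.
exact: (Fubini Ih).
Qed.

End bounded_fubini_swap.

Section layer_cake.
Context {R : realType}.

(** The law of a random level; as a probability it makes the bounded convergence lemma available for
    integrals over levels. *)
Definition unif01 : probability (measurableTypeR R) R := uniform_prob (@ltr01 R).

Lemma unif01_lt (c : R) : 0 <= c <= 1 -> \int[unif01]_r \1_`]-oo, c[%classic r = c.
Proof.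
move=> /andP[c0 c1]; rewrite /Rintegral integral_uniform; last 2 first.
- by apply/measurable_EFinP; exact: measurable_indic.
- by move=> r; rewrite lee_fin indicE.
rewrite integral_indic // subr0 invr1 mul1e.
have -> : `]-oo, c[%classic `&` `[0, 1]%classic = `[0, c[%classic :> set R.
  apply/seteqP; split => r /=; rewrite !in_itv /=; first by move=> [rc /andP[-> _]].
  by move=> /andP[-> rc]; rewrite rc ltW // (lt_le_trans rc).
have e : lebesgue_measure (`[0, c[%classic : set R) = c%:E.
  rewrite lebesgue_measure_itv /= lte_fin; case: ltgtP c0 => //= [c0 _|<- _].
    by rewrite oppr0 addr0.
  by [].
exact: (congr1 fine e).
Qed.

Lemma unif01_eq (c : R) : fine (unif01 [set c]) = 0.
Proof.
rewrite -Rintegral_indic // /Rintegral integral_uniform; last 2 first.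
- by apply/measurable_EFinP; exact: measurable_indic.
- by move=> r; rewrite lee_fin indicE.
rewrite integral_indic //.
have e : lebesgue_measure ([set c] `&` `[0, 1]%classic : set R) = 0%E.
  apply: (@subset_measure0 _ _ _ lebesgue_measure _ [set c]) => //.
    exact: measurableI.
  exact: lebesgue_measure_set1.
exact: (congr1 fine (eq_trans (congr1 (fun x => ((1 - 0)^-1%:E * x)%E) e) (mule0 _))).
Qed.

Context {dT} {T : measurableType dT} (Q : probability T R).

(** Both sides are the mass of [Z], integrated in the two possible orders; the section of [Z] over a
    point [s] of [A] has uniform mass [h s]. The set [A] will be the exceedance event. *)
Lemma layer_cake (A : set T) (h : T -> R) : measurable A ->
  measurable_fun setT h -> (forall s, 0 <= h s <= 1) ->
  \int[unif01]_r fine (Q [set s | A s /\ r < h s]) = \int[Q]_s (\1_A s * h s).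
Proof.
move=> mA mh h01.
pose Z : set (T * measurableTypeR R) := [set z | A z.1 /\ z.2 < h z.1].
have mh1 : measurable_fun setT (fun z : T * measurableTypeR R => h z.1).
  exact: (measurableT_comp mh measurable_fst).
have mZ : measurable Z.
  rewrite (_ : Z = fst @^-1` A `&` (setT `&` (fun z : T * measurableTypeR R => z.2 < h z.1) @^-1` [set true])).
    apply: measurableI; last exact: (measurable_fun_ltr measurable_snd mh1).
    by rewrite -[X in measurable X]setTI; exact: measurable_fst.
  by apply/seteqP; split => z /= [] // ? [].
transitivity (\int[unif01]_r \int[Q]_s (\1_Z (s, r))).
  apply: eq_Rintegral => r _; rewrite -Rintegral_indic //.
  rewrite (_ : [set _ | _] = ysection Z r); first exact: measurable_ysection.
  by apply/seteqP; split => s /=; rewrite /ysection /= inE.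
have m1 : measurable_fun setT (\1_Z : _ -> R) by exact: measurable_indic.
rewrite -(Rintegral_swap Q unif01 m1 (normr_indic_le1 Z)).
apply: eq_Rintegral => s _; rewrite indicE; case: (boolP (s \in A)) => sA.
  rewrite mul1r -[RHS]unif01_lt //; apply: eq_Rintegral => r _.
  rewrite !indicE; congr (_%:R); congr nat_of_bool.
  apply/idP/idP => /set_mem /=; first by move=> [_ rh]; apply/mem_set; rewrite /= in_itv.
  by rewrite in_itv /= => rh; apply/mem_set; split => //; exact: set_mem.
rewrite mul0r -[RHS](Rintegral_prob_cst unif01); apply: eq_Rintegral => r _.
by rewrite indicE memNset //= => -[] /mem_set; rewrite (negbTE sA).
Qed.

(** By Fubini the mean over [r] of the mass of [h = r] equals the [Q]-mean of the uniform mass of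
    the point [h s], which is 0. *)
Lemma ae_level_null (h : T -> R) : measurable_fun setT h ->
  {ae unif01, forall r, fine (Q [set s | h s = r]) = 0}.
Proof.
move=> mh.
pose Z : set (T * measurableTypeR R) := [set z | h z.1 = z.2].
have mh1 : measurable_fun setT (fun z : T * measurableTypeR R => h z.1).
  exact: (measurableT_comp mh measurable_fst).
have mZ : measurable Z.
  rewrite (_ : Z = setT `&` (fun z : T * measurableTypeR R => h z.1 == z.2) @^-1` [set true]).
    exact: (measurable_fun_eqr mh1 measurable_snd).
  by apply/seteqP; split => z /=; [move=> /eqP|move=> [_ /eqP]].
have m1 : measurable_fun setT (\1_Z : _ -> R) by exact: measurable_indic.
have eZ r : fine (Q [set s | h s = r]) = \int[Q]_s \1_Z (s, r).
  rewrite (_ : [set _ | _] = ysection Z r); last first.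
    by apply/seteqP; split => s /=; rewrite /ysection /= inE.
  rewrite -Rintegral_indic; last exact: measurable_ysection.
  by apply: eq_Rintegral => s _; rewrite !indicE mem_ysection.
have mg : measurable_fun setT (fun r : measurableTypeR R => \int[Q]_s (\1_Z (s, r) : R)).
  apply: (@measurable_Rintegral_param _ _ _ Q _ _ (fun z => \1_Z (z.2, z.1)) 1) => [|z]; last exact: normr_indic_le1.
  exact: (measurableT_comp m1 (measurable_swap (T1 := measurableTypeR R) (T2 := T))).
suff : {ae unif01, forall r, \int[Q]_s (\1_Z (s, r) : R) = 0}.
  by apply: filterS => r; rewrite eZ.
apply: (@Rintegral_ae_eq0 _ _ _ unif01 _ 1) => // [r|].
  apply/andP; split; first by apply: Rintegral_ge0 => s _; rewrite indicE.
  rewrite (le_trans (ler_norm _)) //; apply: Rintegral_bounded.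
    exact: (measurableT_comp m1 (pair2_measurable (r : measurableTypeR R))).
  by move=> s; exact: normr_indic_le1.
rewrite -(Rintegral_swap Q unif01 m1 (normr_indic_le1 Z)).
rewrite -[RHS](Rintegral_prob_cst Q); apply: eq_Rintegral => s _.
rewrite -(unif01_eq (h s)) -Rintegral_indic //; apply: eq_Rintegral => r _.
rewrite !indicE; congr (_%:R); congr nat_of_bool.
by apply/idP/idP => /set_mem /= e; apply/mem_set; rewrite /Z /= e.
Qed.

End layer_cake.

(** * Convergence of the direction *)

Section angular_convergence.
Context {R : realType} {d : nat}.
Context {dO} {Omega : measurableType dO} (P : probability Omega R).
Context (X0 : Omega -> 'rV[R]_d) (alpha : R) (Ups : probability (@Rd R d) R).
Hypothesis mX0 : measurable_fun setT (X0 : Omega -> Rd d).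
Hypothesis Ups_sphere : Ups (~` @sphere R d) = 0%E.
Hypothesis RV : forall (u : R), 1 <= u -> forall (S : set (Rd d)), measurable S ->
  S `<=` sphere d -> Ups (sph_boundary S) = 0%E ->
  (fine (P [set w | u * x < enorm (X0 w) /\ S ((enorm (X0 w))^-1 *: X0 w)]) /
   fine (P [set w | x < enorm (X0 w)])) @[x --> +oo]
    --> u `^ (- alpha) * fine (Ups S).

Lemma measurable_closed_Rd (A : set 'rV[R]_d) : closed A -> measurable (A : set (Rd d)).
Proof.
move=> cA; rewrite -[A]setCK; apply: measurableC.
by apply: sub_sigma_algebra; exact: closed_openC.
Qed.

Lemma measurable_sphere : measurable (@sphere R d : set (Rd d)).
Proof. exact: measurable_closed_Rd sphere_closed. Qed.

(** Continuity relative to the sphere, which is what continuous convergence on the sphere provides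
    for the limit functional. *)
Definition sphere_cont (h : 'rV[R]_d -> R) := forall (s_ : nat -> 'rV[R]_d) (s : 'rV[R]_d),
  s_ n @[n --> \oo] --> s -> sphere d s -> (forall n, sphere d (s_ n)) ->
  h (s_ n) @[n --> \oo] --> h s.

Lemma sphere_cont_near h s (D : set R) : sphere_cont h -> sphere d s -> open D ->
  D (h s) -> exists e : R, 0 < e /\ forall s', sphere d s' -> ball s e s' -> D (h s').
Proof.
move=> ch Ss oD Ds.
have [r_ z_ _ zs|e [e0 [M hM]]] := @seq_nbhs_pinfty R 'rV[R]_d s
    (fun _ z => sphere d z -> D (h z)).
  pose s_ n := if pselect (sphere d (z_ n)) then z_ n else s.
  have Ss_ n : sphere d (s_ n) by rewrite /s_; case: pselect.
  have ss : s_ n @[n --> \oo] --> s.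
    apply/cvg_ballP => e e0; have /cvg_ballP /(_ _ e0) := zs; apply: filterS => n.
    by rewrite /s_; case: pselect => [//|nS _]; exact: ballxx.
  have : \forall n \near \oo, D (h (s_ n)).
    by apply: (ch _ _ ss Ss Ss_); exact: open_nbhs_nbhs.
  by apply: filterS => n; rewrite /s_; case: pselect.
exists e; split => // s' Ss' bs; apply: (hM (M + 1)) => //.
by rewrite ltrDl.
Qed.

Definition cap (h : 'rV[R]_d -> R) (r : R) : set (Rd d) := [set s | sphere d s /\ r < h s].

Lemma measurable_cap h r : measurable_fun setT (h : Rd d -> R) -> measurable (cap h r).
Proof.
move=> mh; apply: measurableI; first exact: measurable_sphere.
have := mh measurableT `]r, +oo[%classic (measurable_itv _); rewrite setTI.
by congr measurable; apply/seteqP; split => s /=; rewrite in_itv /= andbT.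
Qed.

(** A cap is relatively open in the sphere, so removing its relative interior removes all of it.
    Euclidean balls are compared with the balls of the sup norm. *)
Lemma sph_boundary_cap h r : sphere_cont h ->
  sph_boundary (cap h r) = closure (cap h r : set 'rV[R]_d) `\` cap h r.
Proof.
move=> ch; rewrite /sph_boundary; congr (_ `\` _).
apply/seteqP; split => [s [] //|s [Ss rs]]; split; first by split.
have [e [e0 he]] := sphere_cont_near (D := [set x | r < x]) ch Ss (@open_gt _ r) rs.
exists e; split => // y [/= ye Sy]; split => //; apply: he => //.
rewrite -ball_normE /ball_ /= distrC.
exact: le_lt_trans (normr_le_enorm _) ye.
Qed.

(** A boundary point lies on the closed sphere outside the cap, so [h s <= r]; were [h s < r], then
    [h < r] nearby on the sphere, and [s] would not be in the closure. *)
Lemma sph_boundary_cap_level h r : sphere_cont h ->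
  sph_boundary (cap h r) `<=` [set s | h s = r].
Proof.
move=> ch s; rewrite sph_boundary_cap // => -[cs ncap] /=.
have Ss : sphere d s.
  by apply: (sphere_closed (d := d)); apply: closure_subset cs => y [].
apply/eqP; rewrite eq_le; apply/andP; split; rewrite leNgt; apply/negP => hr.
  by apply: ncap; split.
have [e [e0 he]] := sphere_cont_near (D := [set x | x < r]) ch Ss (@open_lt _ r) hr.
have [y [[Sy ry] by_]] := cs _ (nbhsx_ballx s e e0).
by have := he y Sy by_; rewrite /= ltNge ltW.
Qed.

Lemma ae_sph_boundary_cap h : measurable_fun setT (h : Rd d -> R) -> sphere_cont h ->
  {ae unif01, forall r, Ups (sph_boundary (cap h r)) = 0%E}.
Proof.
move=> mh ch; have := ae_level_null Ups mh; apply: (@filterS _ _ (ae_filter_ringOfSetsType unif01)) => r hr.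
have ml : measurable ([set s | h s = r] : set (Rd d)).
  by have := mh measurableT [set r] (measurable_set1 r); rewrite setTI.
apply: (@subset_measure0 _ _ _ Ups _ [set s | h s = r]) => //.
- rewrite sph_boundary_cap //; apply: measurableD; last exact: measurable_cap.
  by apply: measurable_closed_Rd; exact: closed_closure.
- exact: sph_boundary_cap_level.
- by rewrite -[LHS]fineK ?hr // fin_num_measure.
Qed.

Local Notation S w := ((enorm (X0 w))^-1 *: X0 w).
Local Notation A x := [set w | x < enorm (X0 w)].

Lemma measurable_exceed x : measurable (A x).
Proof.
have := measurable_enorm_comp mX0 measurableT (measurable_itv `]x, +oo[).
by rewrite setTI; congr measurable; apply/seteqP; split => w /=; rewrite in_itv /= andbT.
Qed.

Lemma measurable_direction : measurable_fun setT (fun w => S w : Rd d).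
Proof. exact: measurable_normalize. Qed.

Lemma exceed_sphere x w : 0 <= x -> A x w -> sphere d (S w).
Proof.
by move=> x0 /= xw; apply: sphere_normalize; rewrite -enorm_gt0 (le_lt_trans x0).
Qed.

Lemma measurable_tail {dT} {T : measurableType dT} (Q : probability T R) (B : set T)
    (h : T -> R) : measurable B -> measurable_fun setT h ->
  measurable_fun setT (fun r : R => fine (Q [set s | B s /\ r < h s]) : R).
Proof.
move=> mB mh; apply: nonincreasing_measurable => // r1 r2 r12.
have mr r : measurable [set s | B s /\ r < h s].
  apply: measurableI => //.
  have := mh measurableT `]r, +oo[%classic (measurable_itv _); rewrite setTI.
  by congr measurable; apply/seteqP; split => s /=; rewrite in_itv /= andbT.
apply: fine_le; rewrite ?fin_num_measure //; apply: le_measure; rewrite ?inE //.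
by move=> s [Bs rs]; split => //; exact: le_lt_trans rs.
Qed.

Lemma fine_prob_le {dT} {T : measurableType dT} (Q : probability T R) (B B' : set T) :
  measurable B -> measurable B' -> B `<=` B' -> fine (Q B) <= fine (Q B').
Proof.
move=> mB mB' BB'; apply: fine_le; rewrite ?fin_num_measure //.
by apply: le_measure; rewrite ?inE.
Qed.

Lemma fine_prob_le1 {dT} {T : measurableType dT} (Q : probability T R) (B : set T) :
  measurable B -> fine (Q B) <= 1.
Proof.
by move=> mB; rewrite -lee_fin fineK; [exact: probability_le1|exact: fin_num_measure].
Qed.

Lemma Rintegral_indic_full {dT} {T : measurableType dT} (Q : probability T R) (B : set T)
    (h : T -> R) : measurable B -> Q (~` B) = 0%E -> measurable_fun setT h ->
  \int[Q]_s (\1_B s * h s) = \int[Q]_s h s.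
Proof.
move=> mB QB mh; congr fine; apply: ae_eq_integral => //.
- by apply/measurable_EFinP; apply: measurable_funM => //; exact: measurable_indic.
- exact/measurable_EFinP.
- exists (~` B); split => //; first exact: measurableC.
  by move=> s /= ns Bs; apply: ns => _; rewrite indicE mem_set ?mul1r.
Qed.

(** For almost every level [r] the hypothesis (RV) applies to [cap h r]. Integrating over [r] by
    bounded convergence and using the layer-cake formula under [P] and under [Ups] gives the claim;
    the ratios [q n r] are at most 1 because [1 <= u]. *)
Lemma angular_cvg01 (h : 'rV[R]_d -> R) (u : R) (x_ : nat -> R) :
  measurable_fun setT (h : Rd d -> R) -> sphere_cont h ->
  (forall s, 0 <= h s <= 1) -> 1 <= u -> (forall n, 0 < x_ n) ->
  x_ n @[n --> \oo] --> +oo ->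
  (\int[P]_w (\1_(A (u * x_ n)) w * h (S w))) / fine (P (A (x_ n))) @[n --> \oo] -->
  u `^ (- alpha) * \int[Ups]_s h s.
Proof.
move=> mh ch h01 u1 x0 xoo.
have ux0 n : 0 <= u * x_ n by rewrite mulr_ge0 ?ltW // (lt_le_trans ltr01).
pose q n r := fine (P [set w | u * x_ n < enorm (X0 w) /\ cap h r (S w)]) / fine (P (A (x_ n))).
have mhS : measurable_fun setT (fun w => h (S w)) by exact: (measurableT_comp mh measurable_direction).
have qE n r : q n r = fine (P [set w | A (u * x_ n) w /\ r < h (S w)]) / fine (P (A (x_ n))).
  rewrite /q; congr (fine (P _) / _); apply/seteqP; split => w [Aw]; first by case.
  by move=> rw; split => //; split => //; exact: exceed_sphere Aw.
have mt n : measurable_fun setT (fun r : R => fine (P [set w | A (u * x_ n) w /\ r < h (S w)])).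
  by apply: measurable_tail => //; exact: measurable_exceed.
have mq n : measurable_fun setT (q n).
  rewrite (_ : q n = fun r => fine (P [set w | A (u * x_ n) w /\ r < h (S w)]) * (fine (P (A (x_ n))))^-1).
    by apply: measurable_funM => //; exact: mt.
  by apply/funext => r; exact: qE.
have mAh n r : measurable [set w | A (u * x_ n) w /\ r < h (S w)].
  apply: measurableI; first exact: measurable_exceed.
  have := mhS measurableT `]r, +oo[%classic (measurable_itv _); rewrite setTI.
  by congr measurable; apply/seteqP; split => s /=; rewrite in_itv /= andbT.
have tb n r : 0 <= fine (P [set w | A (u * x_ n) w /\ r < h (S w)]) <= fine (P (A (x_ n))).
  rewrite fine_ge0 //=; apply: (fine_prob_le P (mAh n r) (measurable_exceed _)).
  move=> w [/= uw _]; apply: le_lt_trans uw.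
  by rewrite ler_peMl // ltW.
have qb n r : `|q n r| <= 1.
  rewrite qE; have /andP[t0 t1] := tb n r.
  have p0 : 0 <= fine (P (A (x_ n))) by rewrite fine_ge0.
  rewrite ger0_norm; last by rewrite divr_ge0.
  (* If the conditioning event is null, the quotient is 0 by the convention for the inverse of 0. *)
  have [->|pn0] := eqVneq (fine (P (A (x_ n)))) 0; first by rewrite invr0 mulr0.
  by rewrite ler_pdivrMr ?mul1r // lt_neqAle eq_sym pn0.
have Iq n : \int[unif01]_r q n r =
    (\int[P]_w (\1_(A (u * x_ n)) w * h (S w))) / fine (P (A (x_ n))).
  rewrite -(layer_cake P (measurable_exceed _) mhS) //.
  rewrite -RintegralZr //; first by apply: eq_Rintegral => r _; exact: qE.
  apply: (@integrable_bounded _ _ _ unif01 _ 1); first exact: mt.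
  move=> r; have /andP[t0 t1] := tb n r; rewrite ger0_norm // (le_trans t1) //.
  exact/fine_prob_le1/measurable_exceed.
have mcap : measurable_fun setT (fun r : R => fine (Ups (cap h r))).
  exact: (measurable_tail Ups measurable_sphere mh).
have IU : \int[unif01]_r (u `^ (- alpha) * fine (Ups (cap h r))) = u `^ (- alpha) * \int[Ups]_s h s.
  rewrite -(Rintegral_indic_full measurable_sphere Ups_sphere mh) -(layer_cake Ups (measurable_sphere) mh) //.
  rewrite RintegralZl //.
  apply: (@integrable_bounded _ _ _ unif01 _ 1); first exact: mcap.
  by move=> r; rewrite ger0_norm ?fine_ge0 //; apply: fine_prob_le1; apply: measurable_cap.
rewrite -IU; have -> : (fun n => (\int[P]_w (\1_(A (u * x_ n)) w * h (S w))) / fine (P (A (x_ n)))) =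
    (fun n => \int[unif01]_r q n r) by apply/funext => n; rewrite Iq.
apply: (@bounded_cvg_Rintegral _ _ _ unif01 _ _ 1) => //.
  exact: measurable_funM.
have := ae_sph_boundary_cap mh ch; apply: (@filterS _ _ (ae_filter_ringOfSetsType unif01)) => r hr.
have := @RV u u1 (cap h r) (measurable_cap r mh) _ hr.
move=> /(_ (fun s hs => hs.1)) /cvg_pinftyP; exact.
Qed.

Lemma angular_cvg (h : 'rV[R]_d -> R) (C u : R) (x_ : nat -> R) :
  measurable_fun setT (h : Rd d -> R) -> sphere_cont h ->
  (forall s, `|h s| <= C) -> 1 <= u -> (forall n, 0 < x_ n) ->
  x_ n @[n --> \oo] --> +oo ->
  (\int[P]_w (\1_(A (u * x_ n)) w * h (S w))) / fine (P (A (x_ n))) @[n --> \oo] -->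
  u `^ (- alpha) * \int[Ups]_s h s.
Proof.
move=> mh ch hC u1 x0 xoo.
(* The affine map from [[-D, D]] onto [[0, 1]] reduces to the previous case; the added 1 keeps [D]
   positive when [C = 0]. *)
pose D := C + 1; have hD s : `|h s| <= D by rewrite (le_trans (hC s)) // lerDl.
have D0 : 0 < D by rewrite (lt_le_trans ltr01) // lerDr (le_trans _ (hC 0)).
pose k s := (h s + D) / (D *+ 2).
have D2 : 0 < D *+ 2 by rewrite mulrn_wgt0.
have hk s : h s = D *+ 2 * k s - D.
  by rewrite /k mulrCA mulfV ?gt_eqF // mulr1 addrK.
have k01 s : 0 <= k s <= 1.
  have := hD s; rewrite ler_norml => /andP[h1 h2]; apply/andP; split.
    by apply: divr_ge0; [lra|exact: ltW].
  by rewrite ler_pdivrMr // mul1r mulr2n lerD2r.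
have mk : measurable_fun setT (k : Rd d -> R).
  by apply: measurable_funM => //; exact: measurable_funD.
have ck : sphere_cont k.
  move=> s_ s ss Ss Ss_; apply: cvgM; last exact: cvg_cst.
  by apply: cvgD; [exact: ch|exact: cvg_cst].
have c1 : sphere_cont (fun=> 1) by move=> *; exact: cvg_cst.
have b1 (s : 'rV[R]_d) : 0 <= (1 : R) <= 1 by rewrite ler01 lexx.
have H1 := angular_cvg01 mk ck k01 u1 x0 xoo.
have H2 := angular_cvg01 (measurable_cst _) c1 b1 u1 x0 xoo.
have IP n (g : 'rV[R]_d -> R) : measurable_fun setT (g : Rd d -> R) -> (forall s, 0 <= g s <= 1) ->
    P.-integrable setT (EFin \o (fun w => \1_(A (u * x_ n)) w * g (S w))).
  move=> mg g01; apply: (@integrable_bounded _ _ _ P _ 1).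
    apply: measurable_funM; last exact: (measurableT_comp mg measurable_direction).
    exact/measurable_indic/measurable_exceed.
  move=> w; rewrite normrM -[leRHS]mulr1; apply: ler_pM => //; first exact: normr_indic_le1.
  by have /andP[g0 g1] := g01 (S w); rewrite ger0_norm.
have lin n : \int[P]_w (\1_(A (u * x_ n)) w * h (S w)) =
    D *+ 2 * \int[P]_w (\1_(A (u * x_ n)) w * k (S w)) - D * \int[P]_w (\1_(A (u * x_ n)) w * 1).
  have Ik := IP n k mk k01; have I1 := IP n (fun=> 1) (measurable_cst _) b1.
  have IZ (c : R) (g : Omega -> R) : P.-integrable setT (EFin \o g) ->
      P.-integrable setT (EFin \o (fun w => c * g w)).
    move=> Ig; rewrite (_ : _ \o _ = (fun w => c%:E * (g w)%:E)%E) //.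
    exact: integrableZl.
  rewrite -(RintegralZl _ measurableT Ik) -(RintegralZl _ measurableT I1).
  rewrite -(RintegralB measurableT (IZ _ _ Ik) (IZ _ _ I1)).
  by apply: eq_Rintegral => w _; rewrite hk; ring.
have Ups1 : \int[Ups]_s h s = D *+ 2 * \int[Ups]_s k s - D * \int[Ups]_s 1.
  have Ik : Ups.-integrable setT (EFin \o k).
    apply: (@integrable_bounded _ _ _ Ups _ 1) => // s.
    by have /andP[k0 k1] := k01 s; rewrite ger0_norm.
  have IZk : Ups.-integrable setT (EFin \o (fun s => D *+ 2 * k s)).
    rewrite (_ : _ \o _ = (fun w => (D *+ 2)%:E * (k w)%:E)%E) //.
    exact: integrableZl.
  have IZ1 : Ups.-integrable setT (EFin \o (fun s => D)).
    exact: (@integrable_bounded _ _ _ Ups _ `|D|).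
  rewrite [\int[Ups]_s 1]Rintegral_prob_cst mulr1 -[X in _ - X](Rintegral_prob_cst Ups).
  rewrite -(RintegralZl _ measurableT Ik) -(RintegralB measurableT IZk IZ1).
  by apply: eq_Rintegral => s _; rewrite hk.
rewrite Ups1 mulrBr !(mulrCA (u `^ _)).
have -> : (fun n => (\int[P]_w (\1_(A (u * x_ n)) w * h (S w))) / fine (P (A (x_ n)))) =
    (fun n => D *+ 2 * ((\int[P]_w (\1_(A (u * x_ n)) w * k (S w))) / fine (P (A (x_ n)))) -
      D * ((\int[P]_w (\1_(A (u * x_ n)) w * 1)) / fine (P (A (x_ n))))).
  by apply/funext => n; rewrite lin mulrBl !mulrA.
by apply: cvgB; (apply: cvgM; first exact: cvg_cst).
Qed.

End angular_convergence.

(** * The conditional law of the rescaled path *)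

Section step_integral.
Context {R : realType} {dT} {T : measurableType dT} (Q : probability T R).

Lemma bounded_Rintegral_sum (f : nat -> T -> R) (C : R) (N : nat) :
  (forall k, measurable_fun setT (f k)) -> (forall k x, `|f k x| <= C) ->
  \int[Q]_x (\sum_(k < N) f k x) = \sum_(k < N) \int[Q]_x f k x.
Proof.
move=> mf fC; elim: N => [|N IH].
  rewrite big_ord0 -[RHS](Rintegral_prob_cst Q); apply: eq_Rintegral => x _.
  by rewrite big_ord0.
rewrite big_ord_recr /= -IH -RintegralD //.
- by apply: eq_Rintegral => x _; rewrite big_ord_recr.
- apply: (@integrable_bounded _ _ _ Q _ (\sum_(k < N) C)).
    by apply: measurable_sum => k.
  by move=> x; rewrite (le_trans (ler_norm_sum _ _ _)) // ler_sum.
- exact: (@integrable_bounded _ _ _ Q _ C).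
Qed.

Local Notation exc_set Y u := [set z | u < Y z].

(** Stated for an arbitrary probability so that one estimate serves both the law of the chain, with
    [Y] the rescaled radius, and [muY], with [Y] the identity. Cells appear as differences of
    exceedance events, the form that (RV) can treat. *)
Lemma Rintegral_step_approx (Y F : T -> R) (h_ : nat -> T -> R) (u_ : nat -> R)
    (N : nat) (eta C : R) :
  measurable_fun setT Y -> measurable_fun setT F ->
  (forall k, measurable_fun setT (h_ k)) ->
  (forall z, `|F z| <= C) -> (forall k z, `|h_ k z| <= C) ->
  {homo u_ : m n / (m <= n)%N >-> m <= n} -> 0 <= eta ->
  (forall k z, (k < N)%N -> u_ k < Y z <= u_ k.+1 -> `|F z - h_ k z| <= eta) ->
  `|\int[Q]_z (\1_(exc_set Y (u_ 0%N)) z * F z) -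
    \sum_(k < N) (\int[Q]_z (\1_(exc_set Y (u_ k)) z * h_ k z) -
                  \int[Q]_z (\1_(exc_set Y (u_ k.+1)) z * h_ k z))| <=
  eta * fine (Q (exc_set Y (u_ 0%N))) + C * fine (Q (exc_set Y (u_ N))).
Proof.
move=> mY mF mh FC hC umono eta0 Fh.
have mE u : measurable (exc_set Y u).
  have := mY measurableT `]u, +oo[%classic (measurable_itv _); rewrite setTI.
  by congr measurable; apply/seteqP; split => s /=; rewrite in_itv /= andbT.
have m1 u : measurable_fun setT (\1_(exc_set Y u) : T -> R) by exact: measurable_indic.
have b1 u (G : T -> R) z : `|G z| <= C -> `|\1_(exc_set Y u) z * G z| <= C.
  move=> GC; rewrite normrM -[leRHS]mul1r; apply: ler_pM => //.
  exact: normr_indic_le1.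
have mM u (G : T -> R) : measurable_fun setT G -> measurable_fun setT (fun z => \1_(exc_set Y u) z * G z).
  by move=> mG; exact: measurable_funM.
have I1 u (G : T -> R) : measurable_fun setT G -> (forall z, `|G z| <= C) ->
    Q.-integrable setT (EFin \o (fun z => \1_(exc_set Y u) z * G z)).
  by move=> mG GC; apply: (@integrable_bounded _ _ _ Q _ C); [exact: mM|move=> z; exact: b1].
pose t_ k z := \1_(exc_set Y (u_ k)) z * h_ k z - \1_(exc_set Y (u_ k.+1)) z * h_ k z.
have mt k : measurable_fun setT (t_ k) by apply: measurable_funB; exact: mM.
have bt k z : `|t_ k z| <= C + C.
  by rewrite (le_trans (ler_normB _ _)) // lerD // b1.
rewrite (eq_bigr (fun k : 'I_N => \int[Q]_z t_ k z)); last first.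
  by move=> k _; rewrite /t_ RintegralB //; exact: I1.
rewrite -(bounded_Rintegral_sum N mt bt).
have Is : Q.-integrable setT (EFin \o (fun z => \sum_(k < N) t_ k z)).
  apply: (@integrable_bounded _ _ _ Q _ (\sum_(k < N) (C + C))).
    by apply: measurable_sum => k.
  by move=> x; rewrite (le_trans (ler_norm_sum _ _ _)) // ler_sum.
rewrite -(RintegralB measurableT (I1 _ _ mF FC) Is).
have ms : measurable_fun setT (fun z => \1_(exc_set Y (u_ 0%N)) z * F z - \sum_(k < N) t_ k z).
  by apply: measurable_funB; [exact: mM|apply: measurable_sum => k; exact: mt].
have bs z : `|\1_(exc_set Y (u_ 0%N)) z * F z - \sum_(k < N) t_ k z| <= C + \sum_(k < N) (C + C).
  rewrite (le_trans (ler_normB _ _)) // lerD ?b1 //.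
  by rewrite (le_trans (ler_norm_sum _ _ _)) // ler_sum.
rewrite (le_trans (le_normr_Rintegral measurableT (integrable_bounded Q ms bs))) //.
have Ie (c : R) u : Q.-integrable setT (EFin \o (fun z => c * \1_(exc_set Y u) z)).
  apply: (@integrable_bounded _ _ _ Q _ `|c|); first exact: measurable_funM.
  by move=> z; rewrite normrM ler_piMr // normr_indic_le1.
have Re (c : R) u : c * fine (Q (exc_set Y u)) = \int[Q]_z (c * \1_(exc_set Y u) z).
  rewrite RintegralZl // ?Rintegral_indic //.
  by apply: (@integrable_bounded _ _ _ Q _ 1) => // z; exact: normr_indic_le1.
rewrite !Re -RintegralD //; apply: le_Rintegral => //.
- apply: (@integrable_bounded _ _ _ Q _ (C + \sum_(k < N) (C + C))).
    exact: measurableT_comp.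
  by move=> z; rewrite normr_id.
- apply: (@integrable_bounded _ _ _ Q _ (`|eta| + `|C|)).
    by apply: measurable_funD; exact: measurable_funM.
  by move=> z; rewrite (le_trans (ler_normD _ _)) // lerD // normrM ler_piMr // normr_indic_le1.
move=> z _.
have indE u : \1_(exc_set Y u) z = (u < Y z)%R%:R :> R by rewrite indicE mem_setE.
rewrite /t_ !indE; under eq_bigr => k _ do rewrite !indE -mulrBl.
case: (ltP (u_ 0%N) (Y z)) => u0Y; last first.
  rewrite mul0r sub0r normrN big1 => [|k _].
    by rewrite normr0 mulr0 add0r mulr_ge0 // (le_trans _ (FC z)).
  rewrite !ltNge (le_trans u0Y) ?umono // (le_trans u0Y) ?umono //=.
  by rewrite subrr mul0r.
rewrite mul1r mulr1.
exact: (step_approx umono eta0 (f := fun=> F z) (a_ := fun k => h_ k z)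
  (fun k kN => Fh k z kN) (FC z) u0Y).
Qed.

End step_integral.

Lemma powR_tail_small {R : realType} (alpha C eta : R) : 0 < alpha -> 0 <= C -> 0 < eta ->
  exists B, 1 <= B /\ C * B `^ (- alpha) <= eta.
Proof.
move=> a0 C0 eta0; pose K := Num.max 1 (C / eta).
have K1 : 1 <= K by rewrite /K le_max lexx.
have K0 : 0 < K by rewrite (lt_le_trans ltr01).
exists (K `^ alpha^-1); split.
  by rewrite -(powRr0 K) ler_powR // invr_ge0 ltW.
rewrite -powRrM mulrN mulVf ?gt_eqF // powR_inv1 ?(ltW K0) //.
rewrite ler_pdivrMr //.
by rewrite mulrC -ler_pdivrMr // /K le_max lexx orbT.
Qed.

(** * Rescaled and limiting path functionals *)

Section forward_tail_chain.
Context {R : realType} {d : nat}.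
Context {dO} {Omega : measurableType dO} (P : probability Omega R).
Context {dE} {E : measurableType dE} (Phi phi : 'rV[R]_d -> E -> 'rV[R]_d).
Context (X0 : Omega -> 'rV[R]_d) (eps : nat -> Omega -> E).
Hypothesis mPhi : measurable_fun [set: Rd d * E] (fun z => (Phi z.1 z.2 : Rd d)).
Hypothesis mX0 : measurable_fun setT (X0 : Omega -> Rd d).
Hypothesis meps : forall i, measurable_fun setT (eps i).
Hypothesis iid : iid_indep_of P (X0 : Omega -> Rd d) eps.
Hypothesis mphi : measurable_fun [set z : Rd d * E | sphere d z.1]
    (fun z : Rd d * E => (phi z.1 z.2 : Rd d)).
Hypothesis Phi_phi : forall (e : E) (s : 'rV[R]_d) (sx : R -> 'rV[R]_d),
  sphere d s -> (forall x, sphere d (sx x)) ->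
  sx x @[x --> +oo] --> s ->
  (x^-1 *: Phi (x *: sx x) e) @[x --> +oo] --> phi s e.
Hypothesis growth :
  (exists s, sphere d s /\ (0 < P [set w | phi s (eps 0%N w) = 0%R :> 'rV[R]_d])%E) ->
   exists W : set E, measurable W /\ P (eps 0%N @^-1` W) = 1%E /\
     forall e, W e -> exists (C x0 : R), forall x, x0 <= x ->
       forall y : 'rV[R]_d, enorm y <= x -> enorm (Phi y e) <= C * x.

Definition Phi_at (r : R) (m : 'rV[R]_d) (e : E) : 'rV[R]_d := r^-1 *: Phi (r *: m) e.

Lemma measurable_Phi_at r :
  measurable_fun [set: Rd d * E] (fun z => (Phi_at r z.1 z.2 : Rd d)).
Proof.
apply: measurable_scale => //; apply: (measurable_kernel mPhi (T := (Rd d * E)%type)).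
  by apply: measurable_scale => //; exact: measurable_fst.
exact: measurable_snd.
Qed.

Let mphie := measurable_phi_ext mphi.

(* If the chain cannot hit [0] then convergence away from [0] suffices;
   otherwise the growth condition gives convergence at [0] as well. *)
Lemma exists_convergence_domain : exists D : set 'rV[R]_d,
  [/\ sphere d `<=` D,
      forall m, D m -> {ae P, forall w, D (phi_ext phi m (eps 0%N w))} &
      forall (r_ : nat -> R) (m : 'rV[R]_d) (m_ : nat -> 'rV[R]_d), r_ n @[n --> \oo] --> +oo ->
        D m -> m_ n @[n --> \oo] --> m ->
        {ae P, forall w, Phi_at (r_ n) (m_ n) (eps 0%N w) @[n --> \oo] -->
                         phi_ext phi m (eps 0%N w)}].
Proof.
case: (pselect (exists s, sphere d s /\
    (0 < P [set w | phi s (eps 0%N w) = 0%R :> 'rV[R]_d])%E)) => hit.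
  have [W [mW [PW hW]]] := growth hit.
  exists setT; split => // [m _|r_ m m_ roo _ mm]; first exact: aeW.
  have [m0|m0] := eqVneq m 0; last by apply: aeW => w; exact: (kernel_cvg_neq0 Phi_phi).
  have mWe : measurable (eps 0%N @^-1` W).
    by rewrite -[X in measurable X]setTI; exact: meps.
  exists (~` (eps 0%N @^-1` W)); split; first exact: measurableC.
    by rewrite probability_setC // PW subee.
  move=> w nw We; apply: nw; have [C [x0 hC]] := hW _ We.
  rewrite m0 in mm *; rewrite /Phi_at; apply: kernel_cvg_0 => //; exact: hC.
exists [set m | m != 0]; split => [s|m m0|r_ m m_ roo m0 mm].
- exact: sphere_neq0.
- have mq : measurable_fun setT (fun w => phi_ext phi m (eps 0%N w) : Rd d).
    exact: (measurable_kernel mphie (q := fun=> m : Rd d) (measurable_cst _) (meps 0%N)).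
  (* By homogeneity hitting 0 from [m] is hitting 0 from its direction, which is a null event in
     this case. *)
  have e0 : [set w | phi_ext phi m (eps 0%N w) = 0] =
      [set w | phi ((enorm m)^-1 *: m) (eps 0%N w) = 0].
    apply/seteqP; split => w /=; rewrite /phi_ext (negbTE m0); last by move=> ->; rewrite scaler0.
    by move/eqP; rewrite scaler_eq0 enorm_eq0 (negbTE m0) => /eqP.
  exists [set w | phi_ext phi m (eps 0%N w) = 0]; split.
  + have := measurable_enorm_comp mq measurableT (measurable_set1 0).
    rewrite setTI; congr measurable; apply/seteqP; split => w /=; last by move=> ->; rewrite enorm0.
    by move/eqP; rewrite enorm_eq0 => /eqP.
  + apply/eqP; rewrite eq_le measure_ge0 andbT leNgt; apply/negP => P0.
    by apply: hit; exists ((enorm m)^-1 *: m); rewrite -e0; split => //; exact: sphere_normalize.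
  + by move=> w /= /negP; rewrite negbK => /eqP.
- by apply: aeW => w; exact: (kernel_cvg_neq0 Phi_phi).
Qed.

Context (t : nat) (f : R * 'M[R]_(t.+1, d) -> R) (C : R).
Hypothesis cf : continuous f.
Hypothesis fC : forall z, `|f z| <= C.

Definition fpath (y : R) (p : nat -> 'rV[R]_d) : R := f (y, \matrix_(j < t.+1) p j).

Lemma measurable_fpath {dT} {T : measurableType dT} (y : T -> R) (q : nat -> T -> 'rV[R]_d) :
  measurable_fun setT y -> (forall j, measurable_fun setT (q j : T -> Rd d)) ->
  measurable_fun setT (fun z => fpath (y z) (q^~ z)).
Proof.
move=> my mq; apply: (measurable_fun_continuous_mx cf my) => i j.
have /measurable_fun_RdP/(_ j) := mq i; congr measurable_fun.
by apply/funext => z; rewrite mxE.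
Qed.

Lemma mpath_fpath {dT} {T : measurableType dT} (y : T -> R) :
  measurable_fun setT y -> mpath (fun z => fpath (y z)).
Proof.
move=> my dS S g q mg mq; apply: (measurable_fpath (y := y \o g)) => //.
exact: measurableT_comp.
Qed.

Lemma fpath_cvg (y_ : nat -> R) y (p_ : nat -> nat -> 'rV[R]_d) p :
  y_ n @[n --> \oo] --> y -> (forall j, p_ n j @[n --> \oo] --> p j) ->
  fpath (y_ n) (p_ n) @[n --> \oo] --> fpath y p.
Proof.
move=> yy pp; apply: (@continuous_cvg _ _ _ _ _ (fun n => (y_ n, \matrix_(j < t.+1) p_ n j)) f).
  exact: cf.
have mm : \matrix_(j < t.+1) p_ n j @[n --> \oo] --> \matrix_(j < t.+1) p j.
  apply: cvg_mxP => i j; under eq_fun => n do rewrite mxE; rewrite mxE.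
  exact: (continuous_cvg _ (@coord_continuous _ _ _ ord0 j (p i)) (pp i)).
apply/cvg_ballP => e e0; have /cvg_ballP /(_ _ e0) hy := yy.
have /cvg_ballP /(_ _ e0) := mm; apply: filterS2 hy => n h1 h2.
by split.
Qed.

(** The mean of the test function given [X_0 = r s]. The rescaled radius [y] is a separate variable
    although it will equal [r / x]: then [r] can diverge while [y] ranges over a compact
    interval. *)
Definition pre_limit (r y : R) (s : 'rV[R]_d) : R := pathInt P eps (Phi_at r) t (fpath y) s.
Definition limit (y : R) (s : 'rV[R]_d) : R := pathInt P eps (phi_ext phi) t (fpath y) s.

Lemma pre_limit_cvg (r_ y_ : nat -> R) (s_ : nat -> 'rV[R]_d) y s :
  r_ n @[n --> \oo] --> +oo -> y_ n @[n --> \oo] --> y -> s_ n @[n --> \oo] --> s ->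
  sphere d s -> (forall n, sphere d (s_ n)) ->
  pre_limit (r_ n) (y_ n) (s_ n) @[n --> \oo] --> limit y s.
Proof.
move=> roo yy ss Ss _; have [D [SD phiD DPhi]] := exists_convergence_domain.
apply: (@pathInt_cvg _ _ _ _ P _ _ eps (meps 0%N) (fun n => Phi_at (r_ n)) (phi_ext phi) D C) => //.
- by move=> n; exact: measurable_Phi_at.
- by move=> m m_ Dm mm; exact: DPhi.
- by move=> n; apply: (mpath_fpath (y := fun=> y_ n)).
- exact: (mpath_fpath (y := fun=> y)).
- by move=> n p; exact: fC.
- by move=> p; exact: fC.
- by move=> p p_ pp; exact: fpath_cvg.
- exact: SD.
Qed.

Lemma measurable_limit :
  measurable_fun setT (fun z : R * Rd d => limit z.1 z.2).
Proof.
apply: (@pathInt_measurable _ _ _ _ P _ _ _ eps mphie (meps 0%N) t _ (R * Rd d)%type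
  (fun z => fpath z.1) (fun z => z.2) C) => //.
- exact: (mpath_fpath measurable_fst).
- by move=> z p; exact: fC.
- exact: measurable_snd.
Qed.

Lemma limit_bounded y s : `|limit y s| <= C.
Proof.
exact: (@pathInt_bounded _ _ _ _ P _ _ _ eps mphie (meps 0%N) t _ unit
  (fun _ => fpath y) C (mpath_fpath (measurable_cst y)) (fun _ _ => fC _) tt s).
Qed.

Lemma limit_sphere_cont y : sphere_cont (limit y).
Proof.
move=> s_ s ss Ss Ss_; apply/cvgrPdist_le => e e0.
have [e1 [e10 [M hM]]] := continuous_convergence_near pre_limit_cvg y e0 Ss.
have /cvg_ballP /(_ _ e10) := ss; apply: filterS => n bn.
by have [_] := hM y (s_ n) (Ss_ n) (conj (ballxx y e10) bn); rewrite distrC.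
Qed.

Local Notation S w := ((enorm (X0 w))^-1 *: X0 w).
Local Notation A x := [set w | x < enorm (X0 w)].

(* The conditioning event and the normalization by [|X_0|] are part of the path
   functional, so that [Rintegral_Xproc] applies to the unscaled chain. *)
Definition Fexc (x : R) (p : nat -> 'rV[R]_d) : R :=
  if x < enorm (p 0%N) then fpath (enorm (p 0%N) / x) (fun j => (enorm (p 0%N))^-1 *: p j) else 0.

Definition exc (x : R) (w : Omega) : R := pathInt P eps Phi t (Fexc x) (X0 w).

Lemma C_ge0 : 0 <= C.
Proof. by rewrite (le_trans _ (fC 0)). Qed.

Lemma Fexc_bounded x p : `|Fexc x p| <= C.
Proof. by rewrite /Fexc; case: ifP => _; [exact: fC|rewrite normr0 C_ge0]. Qed.

Lemma mpath_Fexc x : mpath (fun _ : unit => Fexc x).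
Proof.
move=> dS T g q _ mq; rewrite /Fexc.
have me := measurable_enorm_comp (mq 0%N).
apply: measurable_fun_ifT => //; first exact: measurable_fun_ltr.
apply: (measurable_fpath (y := fun z => enorm (q 0%N z) / x)
  (q := fun j z => (enorm (q 0%N z))^-1 *: q j z)).
  exact: measurable_funM.
by move=> j; exact: measurable_normalize.
Qed.

Lemma measurable_exc x : measurable_fun setT (exc x).
Proof.
exact: (@pathInt_measurable _ _ _ _ P _ _ _ eps mPhi (meps 0%N) t _ _
  (fun _ => Fexc x) X0 C (mpath_cst (mpath_Fexc x)) (fun _ _ => Fexc_bounded x _) mX0).
Qed.

Lemma exc_bounded x w : `|exc x w| <= C.
Proof.
exact: (@pathInt_bounded _ _ _ _ P _ _ _ eps mPhi (meps 0%N) t _ unit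
  (fun _ => Fexc x) C (mpath_Fexc x) (fun _ _ => Fexc_bounded x _) tt (X0 w)).
Qed.

(** Scaling with [r] the norm of [X_0]. On the event [A x] this radius exceeds [x], which is how
    [x --> +oo] forces [r] to be large. *)
Lemma exc_pre_limit x w : 0 < x -> A x w ->
  exc x w = pre_limit (enorm (X0 w)) (enorm (X0 w) / x) (S w).
Proof.
move=> x0 /= xw; have e0 : 0 < enorm (X0 w) by exact: lt_trans xw.
rewrite /exc -{1}(normalizeK (X0 w)) pathInt_scale ?gt_eqF //.
apply: eq_pathInt => p p0; rewrite /Fexc p0 normalizeK xw; congr fpath.
by apply/funext => j; rewrite scalerA mulVf ?scale1r // gt_eqF.
Qed.

Lemma exc_out x w : ~ A x w -> exc x w = 0.
Proof.
move=> xw; rewrite /exc (@eq_pathInt _ _ _ _ P _ _ eps Phi t (Fexc x) (fun=> 0)).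
  apply/eqP; rewrite -normr_le0.
  (* The general bound with constant 0 shows that the zero functional integrates to 0. *)
  apply: (@pathInt_bounded _ _ _ _ P _ _ _ eps mPhi (meps 0%N) t _ unit
    (fun _ _ => 0) 0 _ _ tt (X0 w)); last by move=> *; rewrite normr0.
  by move=> *; exact: measurable_cst.
by move=> p p0; rewrite /Fexc p0; case: ifP => // /xw.
Qed.

Lemma Rintegral_exc x :
  \int[P]_(w in A x) f (enorm (X0 w) / x,
      \matrix_(j < t.+1) ((enorm (X0 w))^-1 *: Xproc Phi X0 eps j w)) =
  \int[P]_w (\1_(A x) w * exc x w).
Proof.
transitivity (\int[P]_w exc x w); last first.
  apply: eq_Rintegral => w _; rewrite indicE; case: (boolP (w \in A x)) => [_|xw].
    by rewrite mul1r.
  by rewrite mul0r exc_out // => /mem_set; rewrite (negbTE xw).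
rewrite -(Rintegral_Xproc mPhi mX0 meps iid (mpath_Fexc x) (Fexc_bounded x)).
rewrite Rintegral_mkcond; apply: eq_Rintegral => w _; rewrite patchE /Fexc min0n /=.
case: (boolP (w \in A x)) => [/set_mem /= xw|/negP xw]; last first.
  by case: ifP => // h; case: xw; exact: mem_set.
rewrite xw /fpath; congr (f (_, _)); apply/matrixP => i j; rewrite !mxE.
congr (_ * (Xproc Phi X0 eps _ w) _ _).
by apply/esym/minn_idPl; rewrite -ltnS.
Qed.

(** * Integration over the radius and the direction *)

Context (alpha : R) (Ups : probability (@Rd R d) R) (muY : probability R R).
Hypothesis alpha0 : 0 < alpha.
Hypothesis Ups_sphere : Ups (~` @sphere R d) = 0%E.
Hypothesis RV : forall (u : R), 1 <= u -> forall (S : set (Rd d)), measurable S ->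
  S `<=` sphere d -> Ups (sph_boundary S) = 0%E ->
  (fine (P [set w | u * x < enorm (X0 w) /\ S ((enorm (X0 w))^-1 *: X0 w)]) /
   fine (P [set w | x < enorm (X0 w)])) @[x --> +oo]
    --> u `^ (- alpha) * fine (Ups S).
Hypothesis muY_tail :
  forall y : R, 1 <= y -> muY `]y, +oo[%classic = (y `^ (- alpha))%:E.

Let gam (y : R) : R := \int[Ups]_s limit y s.

Lemma measurable_limit_section y : measurable_fun setT (limit y : Rd d -> R).
Proof. exact: (measurableT_comp measurable_limit (pair1_measurable (y : R))). Qed.

Lemma measurable_gam : measurable_fun setT gam.
Proof.
apply: (@measurable_Rintegral_param _ _ _ Ups _ _ (fun z : R * Rd d => limit z.1 z.2) C).
  exact: measurable_limit.
by move=> z; exact: limit_bounded.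
Qed.

Lemma gam_bounded y : `|gam y| <= C.
Proof.
apply: Rintegral_bounded; first exact: measurable_limit_section.
by move=> s; exact: limit_bounded.
Qed.

Lemma gam_dist y y' eta : 0 <= eta ->
  (forall s, sphere d s -> `|limit y s - limit y' s| <= eta) -> `|gam y - gam y'| <= eta.
Proof.
move=> eta0 H; have ml z := measurable_limit_section z.
have Il z : Ups.-integrable setT (EFin \o limit z).
  by apply: (@integrable_bounded _ _ _ Ups _ C) => // s; exact: limit_bounded.
rewrite /gam -(RintegralB measurableT (Il y) (Il y')).
have mB : measurable_fun setT (fun s : Rd d => limit y s - limit y' s).
  by apply: measurable_funB; exact: ml.
rewrite -(Rintegral_indic_full measurable_sphere Ups_sphere mB).
apply: Rintegral_bounded.
  by apply: measurable_funM => //; apply: measurable_indic; exact: measurable_sphere.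
move=> s; rewrite indicE; case: (boolP (s \in _)) => [/set_mem Ss|_].
  by rewrite mul1r; exact: H.
by rewrite mul0r normr0.
Qed.

Lemma muY_step_approx (u_ : nat -> R) (N : nat) (eta : R) :
  {homo u_ : m n / (m <= n)%N >-> m <= n} -> u_ 0%N = 1 -> 0 <= eta ->
  (forall k y, (k < N)%N -> u_ k < y <= u_ k.+1 -> `|gam y - gam (u_ k)| <= eta) ->
  `|\int[muY]_y gam y -
    \sum_(k < N) (u_ k `^ (- alpha) * gam (u_ k) - u_ k.+1 `^ (- alpha) * gam (u_ k))| <=
  eta + C * u_ N `^ (- alpha).
Proof.
move=> umono u0 eta0 H.
have u1 k : 1 <= u_ k by rewrite -u0 umono.
have EY (u : R) : [set y | u < y] = `]u, +oo[%classic.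
  by apply/seteqP; split => y /=; rewrite in_itv /= andbT.
have tail (u c : R) : 1 <= u -> \int[muY]_y (\1_[set y | u < y] y * c) = u `^ (- alpha) * c.
  move=> hu; rewrite RintegralZr //.
    by rewrite EY Rintegral_indic // muY_tail.
  apply: (@integrable_bounded _ _ _ muY _ 1) => [|y]; last exact: normr_indic_le1.
  by rewrite EY; exact: measurable_indic.
have := @Rintegral_step_approx _ _ _ muY id gam (fun k _ => gam (u_ k)) u_ N eta C
  (@measurable_id _ _ _) measurable_gam (fun k => measurable_cst _) gam_bounded
  (fun k _ => gam_bounded _) umono eta0 H.
rewrite /= u0 !EY !muY_tail // powR1 mulr1.
have full : muY (~` `]1, +oo[%classic) = 0%E.
  by rewrite probability_setC // muY_tail // powR1 subee.
rewrite (Rintegral_indic_full (measurable_itv _) full measurable_gam).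
under eq_bigr => k _ do rewrite !tail //.
exact.
Qed.

Local Notation ratio x := ((\int[P]_w (\1_(A x) w * exc x w)) / fine (P (A x))).

Lemma exc_cvg_seq (x_ : nat -> R) : (forall n, 0 < x_ n) -> x_ n @[n --> \oo] --> +oo ->
  ratio (x_ n) @[n --> \oo] --> \int[muY]_y gam y.
Proof.
move=> x0 xoo; apply/cvgrPdist_le => e e0.
(* Three [eta] pay for replacing the ratio by [Ln] (one for the cells, two for the part beyond [B]),
   one for [Ln] against [Lam], two for [Lam] against the integral. *)
pose eta := e / 6; have eta0 : 0 < eta by rewrite divr_gt0.
have [B [B1 BC]] := powR_tail_small alpha0 C_ge0 eta0.
have [delta [delta0 [M hM]]] :=
  continuous_convergence_uniform pre_limit_cvg B (sphere_compact (d := d)) eta0.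
(* Enough cells for the mesh [h] of [[1, B]] to be smaller than [delta]. *)
pose N := (Num.truncn ((B - 1) / delta)).+1.
pose h := (B - 1) / N%:R.
have N0 : 0 < N%:R :> R by rewrite ltr0n.
have h0 : 0 <= h by rewrite divr_ge0 ?subr_ge0 // ltW.
have hd : h < delta.
  by rewrite ltr_pdivrMr // mulrC -ltr_pdivrMr // truncnS_gt.
pose u_ (k : nat) : R := 1 + k%:R * h.
have umono : {homo u_ : m n / (m <= n)%N >-> m <= n}.
  by move=> m n mn; rewrite lerD2l ler_wpM2r // ler_nat.
have u0 : u_ 0%N = 1 by rewrite /u_ mul0r addr0.
have uN : u_ N = B by rewrite /u_ /h mulrCA mulfV ?gt_eqF // mulr1 addrC subrK.
have u1 k : 1 <= u_ k by rewrite -u0 umono.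
have cell k y : (k < N)%N -> u_ k < y <= u_ k.+1 -> 1 <= y <= B /\ `|y - u_ k| < delta.
  move=> kN /andP[uy yu]; split.
    apply/andP; split; first exact: le_trans (u1 k) (ltW uy).
    by rewrite -uN (le_trans yu) // umono.
  rewrite gtr0_norm ?subr_gt0 // (le_lt_trans _ hd) // lerBlDl (le_trans yu) //.
  by rewrite /u_ -natr1 mulrDl mul1r addrA.
pose Lam := \sum_(k < N) (u_ k `^ (- alpha) * gam (u_ k) - u_ k.+1 `^ (- alpha) * gam (u_ k)).
have RHS_Lam : `|\int[muY]_y gam y - Lam| <= eta + eta.
  apply: (le_trans (muY_step_approx umono u0 (ltW eta0) _)).
    move=> k y kN /(cell k y kN)[yB yd]; apply: gam_dist; first exact: ltW.
    (* The radius 0 is a placeholder: the second component of [hM] concerns the limit functional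
       alone. *)
    by move=> s Ss; exact: (hM 0 y (u_ k) s yB Ss yd).2.
  by rewrite uN lerD2l.
pose J n u (g : 'rV[R]_d -> R) : R := (\int[P]_w (\1_(A (u * x_ n)) w * g (S w))) / fine (P (A (x_ n))).
pose Ln n := \sum_(k < N) (J n (u_ k) (limit (u_ k)) - J n (u_ k.+1) (limit (u_ k))).
have Ln_Lam : Ln n @[n --> \oo] --> Lam.
  apply: cvg_big => [|k _]; first exact: add_continuous.
  by apply: cvgB; apply: (angular_cvg mX0 Ups_sphere RV (C := C)) => //;
    [exact: measurable_limit_section|exact: limit_sphere_cont|exact: limit_bounded|
     exact: measurable_limit_section|exact: limit_sphere_cont|exact: limit_bounded].
have tail : C * J n B (fun=> 1) @[n --> \oo] --> C * B `^ (- alpha).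
  rewrite -[X in _ --> C * X]mulr1 -[X in _ --> C * (_ * X)](Rintegral_prob_cst Ups).
  apply: cvgM; first exact: cvg_cst.
  apply: (angular_cvg mX0 Ups_sphere RV (C := 1)) => //.
    by move=> *; exact: cvg_cst.
  by move=> s; rewrite normr1.
have near1 : \forall n \near \oo, `|Ln n - Lam| <= eta.
  by have /cvgrPdist_le /(_ _ eta0) := Ln_Lam; apply: filterS => n; rewrite distrC.
have near2 : \forall n \near \oo, C * J n B (fun=> 1) <= eta + eta.
  have /cvgrPdist_le /(_ _ eta0) := tail; apply: filterS => n.
  by rewrite ler_norml => /andP[+ _]; move: BC; lra.
have near3 : \forall n \near \oo, M < x_ n by exact: cvgry_gt xoo _.
near=> n.
have Mx : M < x_ n by near: n.
have EA u : [set w | u < enorm (X0 w) / x_ n] = A (u * x_ n).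
  by apply/seteqP; split => w /=; rewrite ltr_pdivlMr.
have mS k : measurable_fun setT (fun w => limit (u_ k) (S w)).
  exact: (measurableT_comp (measurable_limit_section (u_ k)) (measurable_direction mX0)).
have := @Rintegral_step_approx _ _ _ P (fun w => enorm (X0 w) / x_ n) (exc (x_ n))
  (fun k w => limit (u_ k) (S w)) u_ N eta C _ (measurable_exc _) mS
  (exc_bounded _) (fun k w => limit_bounded _ _) umono (ltW eta0) _.
have mY : measurable_fun setT (fun w => enorm (X0 w) / x_ n).
  by apply: measurable_funM => //; exact: measurable_enorm_comp.
move=> /(_ mY) step.
have {step} := step _.
have cells k w : (k < N)%N -> u_ k < enorm (X0 w) / x_ n <= u_ k.+1 ->
    `|exc (x_ n) w - limit (u_ k) (S w)| <= eta.
  move=> kN uY; have [YB Yd] := cell k _ kN uY.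
  have xr : x_ n < enorm (X0 w).
    have /andP[uY1 _] := uY; have := le_lt_trans (u1 k) uY1.
    by rewrite ltr_pdivlMr // mul1r.
  rewrite exc_pre_limit //; apply: (hM _ _ _ _ YB _ Yd).1.
    by apply: sphere_normalize; rewrite -enorm_gt0 (lt_trans (x0 n)).
  exact: lt_trans xr.
move=> /(_ cells).
rewrite !EA u0 uN mul1r.
set p := fine (P (A (x_ n))) => step.
have p0 : 0 <= p by rewrite fine_ge0.
have r_Ln : `|ratio (x_ n) - Ln n| <= eta + C * J n B (fun=> 1).
  have -> : Ln n = (\sum_(k < N) (\int[P]_z (\1_[set w | u_ k < enorm (X0 w) / x_ n] z * limit (u_ k) (S z)) -
      \int[P]_z (\1_[set w | u_ k.+1 < enorm (X0 w) / x_ n] z * limit (u_ k) (S z)))) / p.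
    by rewrite mulr_suml; apply: eq_bigr => k _; rewrite !EA mulrBl.
  have -> : J n B (fun=> 1) = fine (P (A (B * x_ n))) / p.
    rewrite -(Rintegral_indic P (measurable_exceed mX0 _)) /J; congr (_ / _).
    by apply: eq_Rintegral => w _; rewrite mulr1.
  have -> : ratio (x_ n) = \int[P]_w (\1_(A (x_ n)) w * exc (x_ n) w) / p by [].
  rewrite -mulrBl normrM [X in _ * X]ger0_norm ?invr_ge0 //.
  have [pz|pnz] := eqVneq p 0; first by rewrite pz invr0 !mulr0 addr0; exact: ltW.
  have pp : 0 < p by rewrite lt_neqAle eq_sym pnz.
  rewrite ler_pdivrMr // mulrDl -(mulrA C) divfK //.
have n1 : `|Ln n - Lam| <= eta by near: n.
have n2 : C * J n B (fun=> 1) <= eta + eta by near: n.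
move: RHS_Lam n1 n2 r_Ln; rewrite (_ : e = eta *+ 6); last first.
  by rewrite /eta -mulr_natr divfK.
rewrite !ler_norml; lra.
Unshelve. all: by end_near. Qed.

End forward_tail_chain.

Theorem theorem2p4 (R : realType) (d : nat)
  (dO : measure_display) (Omega : measurableType dO) (P : probability Omega R)
  (dE : measure_display) (E : measurableType dE)
  (Phi : 'rV[R]_d -> E -> 'rV[R]_d)
  (X0 : Omega -> 'rV[R]_d) (eps : nat -> Omega -> E)
  (alpha : R) (Ups : probability (Rd d) R)
  (phi : 'rV[R]_d -> E -> 'rV[R]_d) :
  (* measurability *)
  measurable_fun [set: Rd d * E] (fun z : Rd d * E => (Phi z.1 z.2 : Rd d)) ->
  measurable_fun [set: Omega] (X0 : Omega -> Rd d) ->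
  (forall i, measurable_fun [set: Omega] (eps i)) ->
  (* eps_1, eps_2, ... i.i.d. and independent of X0 *)
  iid_indep_of P (X0 : Omega -> Rd d) eps ->
  (* (RV) *)
  0 < alpha ->
  Ups (~` sphere d) = 0%E ->
  (forall (u : R), 1 <= u -> forall (S : set (Rd d)), measurable S ->
     S `<=` sphere d -> Ups (sph_boundary S) = 0%E ->
     (fine (P [set w | u * x < enorm (X0 w) /\
                        S ((enorm (X0 w))^-1 *: X0 w)]) /
      fine (P [set w | x < enorm (X0 w)])) @[x --> +oo]
       --> u `^ (- alpha) * fine (Ups S)) ->
  (* (Phi) *)
  measurable_fun [set z : Rd d * E | sphere d z.1]
    (fun z : Rd d * E => (phi z.1 z.2 : Rd d)) ->
  (forall (e : E) (s : 'rV[R]_d) (sx : R -> 'rV[R]_d),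
     sphere d s -> (forall x, sphere d (sx x)) ->
     sx x @[x --> +oo] --> s ->
     (x^-1 *: Phi (x *: sx x) e) @[x --> +oo] --> phi s e) ->
  ((exists s, sphere d s /\ (0 < P [set w | phi s (eps 0%N w) = 0%R :> 'rV[R]_d])%E) ->
   exists W : set E, measurable W /\ P (eps 0%N @^-1` W) = 1%E /\
     forall e, W e -> exists (C x0 : R), forall x, x0 <= x ->
       forall y : 'rV[R]_d, enorm y <= x -> enorm (Phi y e) <= C * x) ->
  (* conclusion: weak convergence, tested against bounded continuous f *)
  forall (muY : probability R R),
  (forall y : R, 1 <= y -> muY `]y, +oo[%classic = (y `^ (- alpha))%:E) ->
  forall (t : nat) (f : R * 'M[R]_(t.+1, d) -> R),
    continuous f -> (exists C : R, forall z, `|f z| <= C) ->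
    (fine (\int[P]_(w in [set w | x < enorm (X0 w)])
              (f (enorm (X0 w) / x,
                  \matrix_(j < t.+1) ((enorm (X0 w))^-1 *: Xproc Phi X0 eps j w)))%:E) /
     fine (P [set w | x < enorm (X0 w)])) @[x --> +oo]
    --> fine (\int[muY]_y
              (fine (\int[Ups]_s
                 (pathInt P eps (phi_ext phi) t
                    (fun p => f (y, \matrix_(j < t.+1) p j)) s)%:E))%:E).
Proof.
move=> mPhi mX0 meps iid alpha0 UpsS RV mphi Phi_phi growth muY muY_tail t f cf [C fC].
apply/(cvg_pinftyP (fun x => fine (\int[P]_(w in [set w | x < enorm (X0 w)])
    (f (enorm (X0 w) / x,
        \matrix_(j < t.+1) ((enorm (X0 w))^-1 *: Xproc Phi X0 eps j w)))%:E) /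
    fine (P [set w | x < enorm (X0 w)]))) => x xoo.
(* Positive for every [n], as [exc_cvg_seq] demands, and eventually equal to [x n]. *)
pose x' n := Num.max (x n) 1.
have x'0 n : 0 < x' n by rewrite /x' lt_max ltr01 orbT.
have xx' : \forall n \near \oo, x' n = x n.
  have : \forall n \near \oo, 1 < x n by exact: cvgry_gt xoo _.
  apply: filterS => n x1.
  by rewrite /x' max_l // ltW.
have x'oo : x' n @[n --> \oo] --> +oo.
  by apply: cvg_trans xoo; apply: near_eq_cvg; apply: filterS xx' => n ->.
have H := exc_cvg_seq mPhi mX0 meps mphi Phi_phi growth cf fC alpha0 UpsS RV muY_tail x'0 x'oo.
apply: cvg_trans H; apply: near_eq_cvg; apply: filterS xx' => n ->.
by rewrite -(Rintegral_exc mPhi mX0 meps iid cf fC).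
Qed.
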